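(* Let $\mathcal{A}\in\mathbb{S}^{[m,n]}$, and let $\mathcal{B}\in\mathbb{S}_+^{[m',n]}$ with $m'$ even. Let $\{x_k\}$ and $\{\lambda_k\}$ be (infinite) sequences generated by the feasible conjugate gradient (FCG) algorithm described in the context. Then $\{\lambda_k\}$ monotonically converges to a $\mathcal{B}$-eigenvalue $\lambda^*$ of $\mathcal{A}$, and any accumulation point $x^*$ of $\{x_k\}$ is a $\mathcal{B}$-eigenvector of $\mathcal{A}$ associated with $\lambda^*$.
   Context: Let $m,n,m'$ be positive integers. $\mathbb{R}^{[m,n]}$ is the set of real tensors $\mathcal{A}=(a_{i_1\ldots i_m})$ of order $m$ and dimension $n$ (indices in $\{1,\dots,n\}$), and $\mathbb{R}^{[1,n]}=\mathbb{R}^n$. For $x\in\mathbb{R}^n$, $\mathcal{A}x^m:=\sum_{i_1,\dots,i_m=1}^n a_{i_1\ldots i_m}x_{i_1}\cdots x_{i_m}\in\mathbb{R}$. $\mathcal{A}x^{m-1}\in\mathbb{R}^n$ is the vector with entries $(\mathcal{A}x^{m-1})_i=\sum_{j_1,\dots,j_{m-1}=1}^n a_{ij_1\ldots j_{m-1}}x_{j_1}\cdots x_{j_{m-1}}$. The same notation is used for $\mathcal{B}$ with $m'$ in place of $m$. $\mathcal{A}$ is symmetric if its entries are invariant under all permutations of the indices. $\mathbb{S}^{[m,n]}$ is the set of symmetric tensors in $\mathbb{R}^{[m,n]}$. $\mathbb{S}_+^{[m,n]}$ is the set of positive definite ones, i.e. those with $\mathcal{A}x^m>0$ for all $x\in\mathbb{R}^n\setminus\{0\}$.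 A number $\lambda\in\mathbb{R}$ is a $\mathcal{B}$-eigenvalue of $\mathcal{A}$ if there is $x\in\mathbb{R}^n\setminus\{0\}$ with $\mathcal{A}x^{m-1}=\lambda\mathcal{B}x^{m'-1}$ and $\mathcal{B}x^{m'}=1$. Such an $x$ is called a $\mathcal{B}$-eigenvector associated with $\lambda$. $\|\cdot\|$ is the Euclidean norm. For $y\in\mathbb{R}^n$, $\|y\|_{\mathcal{B}}:=(\mathcal{B}y^{m'})^{1/m'}$. Put $f(x)=\frac1m\mathcal{A}x^m$, $\mathbb{B}=\{x\in\mathbb{R}^n\mid\mathcal{B}x^{m'}=1\}$ and $F(x)=\mathcal{A}x^{m-1}-(\mathcal{A}x^m)\,\mathcal{B}x^{m'-1}$. FCG algorithm. Constants: $\rho\in(0,1)$, $\sigma_1\in(0,1)$, $\sigma_2>0$, $\delta>0$. Given an initial $u_0\in\mathbb{R}^n\setminus\{0\}$, set $x_0=u_0/\|u_0\|_{\mathcal{B}}$, $\lambda_0=\mathcal{A}x_0^m$ and $k=0$. While $F(x_k)\ne0$, perform the following steps. 1. Set $d_0=-F(x_0)$ if $k=0$. If $k>0$, set $$d_k=-F(x_k)+\beta_{k-1}d_{k-1}-\theta_{k-1}y_{k-1},$$ $$y_{k-1}=F(x_k)-F(x_{k-1}),\quad \beta_{k-1}=\frac{F(x_k)^\top y_{k-1}}{\|F(x_{k-1})\|^2},\quad \theta_{k-1}=\frac{F(x_k)^\top d_{k-1}}{\|F(x_{k-1})\|^2}.$$ 2. With $x_k(\alpha):=\dfrac{x_k+\alpha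 d_k}{\|x_k+\alpha d_k\|_{\mathcal{B}}}$, let $\alpha_k$ be the largest element of $\{\delta\rho^i\mid i=0,1,2,\dots\}$ satisfying $$f(x_k(\alpha_k))\le f(x_k)+\sigma_1\alpha_kF(x_k)^\top d_k-\sigma_2\alpha_k^2\|d_k\|^2.$$ 3. Set $x_{k+1}=x_k(\alpha_k)$ and $\lambda_{k+1}=\mathcal{A}x_{k+1}^m$, and replace $k$ by $k+1$. The algorithm stops if $F(x_k)=0$. The statement concerns the case where it does not stop, so that the generated sequences are infinite. *)

(* Defs.v *)
From HB Require Import structures.
From mathcomp Require Import all_boot all_order all_algebra all_fingroup.
From mathcomp Require Import all_classical all_reals all_analysis.
Set Implicit Arguments.
Unset Strict Implicit.
Unset Printing Implicit Defensive.
Import Order.TTheory GRing.Theory Num.Theory.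
Import numFieldNormedType.Exports.
Local Open Scope classical_set_scope.
Local Open Scope ring_scope.

Definition tensor (R : Type) (m n : nat) := {ffun m.-tuple 'I_n -> R}.

(* A x^m *)
Definition tform (R : realType) (m n : nat) (A : tensor R m n)
    (x : 'rV[R]_n) : R :=
  \sum_(i : m.-tuple 'I_n) A i * \prod_(k < m) x 0 (tnth i k).

(* A x^(m-1), for a tensor A of order m >= 1; the order is written m.+1 so that
   the first index can be split off. *)
Definition tvec (R : realType) (m n : nat) (A : tensor R m.+1 n)
    (x : 'rV[R]_n) : 'rV[R]_n :=
  \row_(i < n) \sum_(j : m.-tuple 'I_n)
    A [tuple of i :: j] * \prod_(k < m) x 0 (tnth j k).

Definition symmetric_tensor (R : realType) (m n : nat) (A : tensor R m n) :=
  forall (s : 'S_m) (i : m.-tuple 'I_n), A [tuple tnth i (s k) | k < m] = A i.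

Definition posdef_tensor (R : realType) (m n : nat) (A : tensor R m n) :=
  forall x : 'rV[R]_n, x != 0 -> 0 < tform A x.

Definition B_eigenvector (R : realType) (m m' n : nat) (A : tensor R m.+1 n)
    (B : tensor R m'.+1 n) (lambda : R) (x : 'rV[R]_n) :=
  [/\ x != 0, tvec A x = lambda *: tvec B x & tform B x = 1].

Definition B_eigenvalue (R : realType) (m m' n : nat) (A : tensor R m.+1 n)
    (B : tensor R m'.+1 n) (lambda : R) :=
  exists x : 'rV[R]_n, B_eigenvector A B lambda x.

Definition dotv (R : realType) (n : nat) (u v : 'rV[R]_n) : R :=
  \sum_(i < n) u 0 i * v 0 i.

(* The library norm on 'rV[R]_n is the sup norm. *)
Definition enorm (R : realType) (n : nat) (u : 'rV[R]_n) : R :=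
  Num.sqrt (dotv u u).

Definition Bnorm (R : realType) (m' n : nat) (B : tensor R m' n)
    (y : 'rV[R]_n) : R :=
  tform B y `^ (m'%:R)^-1.

Definition Bnormalize (R : realType) (m' n : nat) (B : tensor R m' n)
    (y : 'rV[R]_n) : 'rV[R]_n :=
  (Bnorm B y)^-1 *: y.

Definition objective (R : realType) (m n : nat) (A : tensor R m n)
    (x : 'rV[R]_n) : R :=
  (m%:R)^-1 * tform A x.

Definition residual (R : realType) (m m' n : nat) (A : tensor R m.+1 n)
    (B : tensor R m'.+1 n) (x : 'rV[R]_n) : 'rV[R]_n :=
  tvec A x - tform A x *: tvec B x.

Definition admissible_steps (R : realType) (m m' n : nat)
    (A : tensor R m.+1 n) (B : tensor R m'.+1 n)
    (rho sigma1 sigma2 delta : R) (x d : 'rV[R]_n) : set R :=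
  [set a | (exists i : nat, a = delta * rho ^+ i) /\
    objective A (Bnormalize B (x + a *: d)) <=
      objective A x + sigma1 * a * dotv (residual A B x) d
      - sigma2 * a ^+ 2 * enorm d ^+ 2].

(* An infinite run: the stopping test F(x_k) = 0 never succeeds. *)
Record FCG_run (R : realType) (m m' n : nat)
    (A : tensor R m.+1 n) (B : tensor R m'.+1 n)
    (rho sigma1 sigma2 delta : R) (u0 : 'rV[R]_n)
    (x d : nat -> 'rV[R]_n) (alpha lambda : nat -> R) : Prop := {
  FCG_x0 : x 0%N = Bnormalize B u0 ;
  FCG_lambda : forall k, lambda k = tform A (x k) ;
  FCG_continue : forall k, residual A B (x k) != 0 ;
  FCG_d0 : d 0%N = - residual A B (x 0%N) ;
  FCG_dS : forall k,
    let F := residual A B (x k) in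
    let F' := residual A B (x k.+1) in
    let y := F' - F in
    let beta := dotv F' y / enorm F ^+ 2 in
    let theta := dotv F' (d k) / enorm F ^+ 2 in
    d k.+1 = - F' + beta *: d k - theta *: y ;
  FCG_alpha : forall k,
    let S := admissible_steps A B rho sigma1 sigma2 delta (x k) (d k) in
    S (alpha k) /\ ubound S (alpha k) ;
  FCG_xS : forall k, x k.+1 = Bnormalize B (x k + alpha k *: d k)
}.

(* Main.v *)
Require Import Defs.
From mathcomp Require Import all_boot all_order all_algebra.
From mathcomp Require Import all_classical all_reals all_analysis.
From mathcomp Require Import perm lra ring zify.
From mathcomp Require ordered_qelim qe_rcf.
Import Order.TTheory GRing.Theory Num.Theory.
Import numFieldNormedType.Exports.
Import ordered_qelim.
Local Open Scope classical_set_scope.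
Local Open Scope ring_scope.
Set Implicit Arguments.
Unset Strict Implicit.
Unset Printing Implicit Defensive.

(* Write [F_k] for the residual at [x_k], [s_k] for [alpha_k |d_k|] and [Delta_k]
   for [lambda_k - lambda_star]. The directions satisfy [F_k . d_k = - |F_k|^2],
   so the line search gives [Delta_k - Delta_(k+1) >= c (alpha_k |F_k|^2 + s_k^2)].
   The usual argument only yields [liminf |F_k| = 0]; for [lim F_k = 0] one has to
   exclude that the run travels forever between critical points at the level
   [lambda_star].

   If [|F_k| >= 2 eps], then [|F| >= eps] during the next [N ~ c / Delta_k] steps,
   since [sum s^2 <= Delta_k]. In this range the step sizes force [|d|] to be large,
   so the recursion for [d] is dominated by [|d_(j+1)| <= q |d_j|] with [q] as small
   as we want; hence [|d_k| >= q^(-N)], which is at least [exp (Q / Delta_k)] for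
   every [Q] when [k] is large. On the other hand [|d|] grows at most by the factor
   [exp (C (s_j / |F_j|)^2)] in one step, so the Lojasiewicz type inequality
   [|F| >= c Delta] gives [|d_k| <= C exp (C sum (Delta_j - Delta_(j+1)) / Delta_j^2)
   <= C exp (C / Delta_k)], a contradiction.

   The inequality [|F| >= c Delta] near a level of [A x^m] on the sphere is a
   consequence of quantifier elimination over real closed fields: a definable
   selection of points of level [t] with [|F| <= eps t] has coordinates whose
   upper level sets have a number of endpoints bounded independently of [eps] and
   of the level, so it has bounded variation, and the level cannot vary enough
   along it. *)

(** * Uniform finiteness for one-variable definable sets *)

Definition changes (u : nat -> bool) (K : nat) : nat :=
  (\sum_(k < K) (u k (+) u k.+1))%N.

Lemma changes_comp2 (op : bool -> bool -> bool) (u v : nat -> bool) K :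
  (changes (fun k => op (u k) (v k)) K <= changes u K + changes v K)%N.
Proof.
rewrite /changes -big_split /=; apply: leq_sum => k _.
by case: (u k) (u k.+1) (v k) (v k.+1) => [] [] [] []; rewrite ?addbb //; case: (_ (+) _).
Qed.

Lemma changes_comp (op : bool -> bool) (u : nat -> bool) K :
  (changes (fun k => op (u k)) K <= changes u K)%N.
Proof.
apply: leq_sum => k _.
by case: (u k) (u k.+1) => [] []; rewrite ?addbb //; case: (_ (+) _).
Qed.

Lemma changes_eq (u v : nat -> bool) K : u =1 v -> changes u K = changes v K.
Proof. by move=> uv; apply: eq_bigr => k _; rewrite !uv. Qed.

Lemma changes_cst b K : changes (fun=> b) K = 0%N.
Proof. by apply: big1 => k _; rewrite addbb. Qed.

Definition increasing_upto (R : realType) (tau : nat -> R) (K : nat) :=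
  forall i j, (i < j <= K)%N -> tau i < tau j.

(** Variable 0 runs along a subdivision while the other entries of [e] act as parameters; every
    bound has to be uniform in these. *)
Definition at0 (R : realType) (e : seq R) (x : R) := set_nth 0 e 0 x.

Section PolyChanges.
Variable R : realType.
Implicit Types (tau : nat -> R) (p : {poly R}).

(* Each change is charged to a root in a closed interval of the subdivision;
   the intervals of a given parity are disjoint, so each parity costs at most
   the number of roots. *)
Lemma changes_roots p tau K (u : nat -> bool) : p != 0 ->
  increasing_upto tau K ->
  (forall k, (k < K)%N -> u k (+) u k.+1 ->
     exists2 r, tau k <= r <= tau k.+1 & root p r) ->
  (changes u K <= 2 * size p)%N.
Proof.
move=> p0 inc rt.
have rP k : exists r : R, (k < K)%N -> u k (+) u k.+1 ->
     tau k <= r <= tau k.+1 /\ root p r.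
  have [kK|] := boolP ((k < K)%N && (u k (+) u k.+1)).
    by case/andP: kK => kK uk; have [r ? ?] := rt k kK uk; exists r.
  by rewrite negb_and => H; exists 0 => h1 h2; move: H; rewrite h1 h2.
have [r {}rP] := choice rP.
have par (b : bool) :
    (size [seq k <- iota 0 K | (u k (+) u k.+1) && (odd k == b)] <= size p)%N.
  rewrite -(size_map r) ltnW // max_poly_roots //.
    apply/allP => _ /mapP[k + ->]; rewrite mem_filter mem_iota /= add0n.
    by case/andP => /andP[uk _] kK; have [] := rP k kK uk.
  rewrite map_inj_in_uniq ?filter_uniq ?iota_uniq // => i j.
  rewrite !mem_filter !mem_iota /= !add0n => /andP[/andP[ui oi] iK] /andP[/andP[uj oj] jK].
  have [/andP[a1 a2] _] := rP i iK ui; have [/andP[b1 b2] _] := rP j jK uj => rij.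
  have E : odd i = odd j by rewrite (eqP oi) (eqP oj).
  have H (x y : nat) : (x < y)%N -> odd x = odd y -> (x.+1 < y)%N.
    move=> xy oxy; rewrite ltn_neqAle xy andbT; apply/eqP => xy1.
    by move: oxy; rewrite -xy1 /=; case: odd.
  have [ij|ji|//] := ltngtP i j.
    have h : tau i.+1 < tau j by apply: inc; rewrite (H i j ij E) ltnW.
    by have := lt_le_trans (le_lt_trans a2 h) b1; rewrite rij ltxx.
  have h : tau j.+1 < tau i by apply: inc; rewrite (H j i ji (esym E)) ltnW.
  by have := lt_le_trans (le_lt_trans b2 h) a1; rewrite rij ltxx.
have -> : changes u K = size [seq k <- iota 0 K | u k (+) u k.+1].
  by rewrite size_filter -sumn_count /changes sumnE big_map -[K in iota 0 K]subn0 big_mkord.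
rewrite mul2n -addnn.
apply: leq_trans (leq_add (par true) (par false)).
rewrite !size_filter -(count_predUI _ _) -[leqLHS]addn0 leq_add //.
by apply: sub_count => k /= ->; case: odd.
Qed.

Lemma poly_sign_root p (a b : R) : a <= b -> p.[a] * p.[b] <= 0 ->
  exists2 r, a <= r <= b & root p r.
Proof.
move=> ab; case: (leP p.[a] 0) => pa; case: (leP p.[b] 0) => pb H.
- have [pb0|pb0] := eqVneq p.[b] 0; first by exists b; rewrite ?ab ?lexx // /root pb0.
  have pb1 : p.[b] < 0 by rewrite lt_neqAle pb0.
  have pa0 : p.[a] = 0 by apply: le_anti; rewrite pa /=; nra.
  by exists a; rewrite ?ab ?lexx // /root pa0.
- have [r rab rp] := @poly_ivt R p a b ab (introT andP (conj pa (ltW pb))).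
  by exists r; rewrite // -in_itv.
- have [r rab rp] : exists2 r, r \in `[a, b] & root (- p) r.
    by apply: poly_ivt => //; rewrite !hornerN oppr_le0 oppr_ge0 (ltW pa) pb.
  by exists r; rewrite -?in_itv // -rootN.
- by have := mulr_gt0 pa pb; lra.
Qed.

Lemma changes_gt0 p tau K : increasing_upto tau K ->
  (changes (fun k => (0 < p.[tau k])%R) K <= 2 * size p)%N.
Proof.
move=> inc; have [->|p0] := eqVneq p 0.
  by rewrite (@changes_eq _ (fun=> false)) ?changes_cst // => k; rewrite horner0 ltxx.
apply: (changes_roots p0 inc) => k kK uk; apply: poly_sign_root.
  by rewrite ltW // inc // ltnSn.
by move: uk; do 2 case: ltP => //=; nra.
Qed.

Lemma changes_eq0 p tau K : increasing_upto tau K ->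
  (changes (fun k => (p.[tau k] == 0)%R) K <= 2 * size p)%N.
Proof.
move=> inc; have [->|p0] := eqVneq p 0.
  by rewrite (@changes_eq _ (fun=> true)) ?changes_cst // => k; rewrite horner0 eqxx.
apply: (changes_roots p0 inc) => k kK uk; apply: poly_sign_root.
  by rewrite ltW // inc // ltnSn.
by move: uk; case: eqP => [->|_]; case: eqP => [->|_]; rewrite ?mul0r ?mulr0.
Qed.

(** Once the other variables are fixed, a term without inverses is a polynomial in variable 0 whose
    length is read off from the term alone, so [N] does not depend on [e]. *)
Lemma term_poly (t : GRing.term R) : GRing.rterm t ->
  exists N, forall e, exists2 p : {poly R}, (size p <= N)%N &
    forall x, GRing.eval (at0 e x) t = p.[x].
Proof.
move=> rt; exists (size (qe_rcf.abstrX 0 (qe_rcf.to_rterm t))) => e.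
exists (qe_rcf.eval_poly e (qe_rcf.abstrX 0 (qe_rcf.to_rterm t))).
  by rewrite qe_rcf.eval_polyP (leq_trans (size_Poly _)) // size_map.
by move=> x; rewrite qe_rcf.abstrXP qe_rcf.evalE qe_rcf.to_rtermE.
Qed.

(** An atom tests the sign or the vanishing of a difference of two polynomials of bounded size, and
    under binary connectives the numbers of changes at most add up. *)
Lemma qf_changes (f : ord.formula R) : ord.qf_form f -> ord.rformula f ->
  exists N, forall e tau K, increasing_upto tau K ->
   (changes (fun k => ord.qf_eval (at0 e (tau k)) f) K <= N)%N.
Proof.
have two (t1 t2 : GRing.term R) (F : R -> bool) :
   (forall p tau K, increasing_upto tau K ->
      (changes (fun k => F p.[tau k]) K <= 2 * size p)%N) ->
   GRing.rterm t1 && GRing.rterm t2 ->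
   exists N, forall e tau K, increasing_upto tau K ->
   (changes (fun k => F (GRing.eval (at0 e (tau k)) t2
                        - GRing.eval (at0 e (tau k)) t1)%R) K <= N)%N.
  move=> hF /andP[/term_poly[N1 H1] /term_poly[N2 H2]].
  exists (2 * maxn N2 N1)%N => e tau K inc.
  have [p ps pE] := H1 e; have [q qs qE] := H2 e.
  have -> : changes (fun k => F (GRing.eval (at0 e (tau k)) t2
                        - GRing.eval (at0 e (tau k)) t1)%R) K =
            changes (fun k => F (q - p).[tau k]) K.
    by apply: changes_eq => k; rewrite pE qE hornerD hornerN.
  rewrite (leq_trans (hF _ _ _ inc)) // leq_mul2l /=.
  rewrite (leq_trans (size_polyD _ _)) // size_polyN geq_max.
  by rewrite (leq_trans qs) ?leq_maxl //= (leq_trans ps) // leq_maxr.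
elim: f => //=.
- by move=> b _ _; exists 0%N => e tau K _; rewrite changes_cst.
- move=> t1 t2 _ rt; have [N HN] := two t1 t2 (eq_op^~ 0) changes_eq0 rt.
  exists N => e tau K inc; rewrite (leq_trans _ (HN e tau K inc)) //.
  by rewrite eq_leq //; apply: changes_eq => k; rewrite subr_eq0 eq_sym.
- move=> t1 t2 _ rt; have [N HN] := two t1 t2 (Order.lt 0) changes_gt0 rt.
  exists N => e tau K inc; rewrite (leq_trans _ (HN e tau K inc)) //.
  by rewrite eq_leq //; apply: changes_eq => k; rewrite subr_gt0.
- move=> t1 t2 _; rewrite andbC => rt; have [N HN] := two t2 t1 (Order.lt 0) changes_gt0 rt.
  exists N => e tau K inc; rewrite (leq_trans _ (HN e tau K inc)) //.
  rewrite (leq_trans _ (changes_comp negb _ _)) //.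
  by rewrite eq_leq //; apply: changes_eq => k; rewrite subr_gt0 leNgt.
- move=> f1 I1 f2 I2 /andP[q1 q2] /andP[r1 r2].
  have [N1 H1] := I1 q1 r1; have [N2 H2] := I2 q2 r2.
  exists (N1 + N2)%N => e tau K inc; rewrite (leq_trans (changes_comp2 andb _ _ _)) //.
  by rewrite leq_add ?H1 ?H2.
- move=> f1 I1 f2 I2 /andP[q1 q2] /andP[r1 r2].
  have [N1 H1] := I1 q1 r1; have [N2 H2] := I2 q2 r2.
  exists (N1 + N2)%N => e tau K inc; rewrite (leq_trans (changes_comp2 orb _ _ _)) //.
  by rewrite leq_add ?H1 ?H2.
- move=> f1 I1 f2 I2 /andP[q1 q2] /andP[r1 r2].
  have [N1 H1] := I1 q1 r1; have [N2 H2] := I2 q2 r2.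
  exists (N1 + N2)%N => e tau K inc; rewrite (leq_trans (changes_comp2 implb _ _ _)) //.
  by rewrite leq_add ?H1 ?H2.
- move=> f I q r; have [N HN] := I q r.
  by exists N => e tau K inc; rewrite (leq_trans (changes_comp negb _ _)) ?HN.
Qed.

(* [P] is a property of the assignment [e] of values to the variables. *)
Definition definable (P : seq R -> Prop) :=
  exists2 f : ord.formula R, ord.rformula f & forall e, ord.holds e f <-> P e.

(** Quantifiers are eliminated once, before the parameters are chosen; this makes [N] uniform in
    [e]. *)
Lemma definable_changes P : definable P ->
  exists N, forall e tau K, increasing_upto tau K ->
   (changes (fun k => `[< P (at0 e (tau k)) >]) K <= N)%N.
Proof.
move=> [f rf fP].
have [g wf gP] : exists2 g, ord.qf_form g && ord.rformula g &
    forall e, ord.holds e f <-> ord.qf_eval e g.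
  have wf := ord.quantifier_elim_wf (@qe_rcf.wf_QE_wproj R) rf.
  exists (ord.quantifier_elim
    (fun i bc => qe_rcf.qfr_to_formula (@qe_rcf.wproj R i bc)) f) => //.
  move=> e; apply: rwP; apply: ord.quantifier_elim_rformP rf.
    exact: qe_rcf.wf_QE_wproj.
  exact: qe_rcf.valid_QE_wproj.
have [N HN] : exists N, forall e tau K, increasing_upto tau K ->
   (changes (fun k => ord.qf_eval (at0 e (tau k)) g) K <= N)%N.
  by case/andP: wf => *; apply: qf_changes.
exists N => e tau K inc; rewrite (leq_trans _ (HN e tau K inc)) // eq_leq //.
apply: changes_eq => k; apply/asboolP/idP => [/fP /gP //|/gP /fP //].
Qed.

End PolyChanges.

(** * Definable predicates and total variation *)

Section Definability.
Variable R : realType.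
Implicit Types (P Q : seq R -> Prop) (g h : seq R -> R).

(** [rterm] excludes inverses, so these are the polynomial functions of the assignment. *)
Definition term_fun g :=
  exists2 t : GRing.term R, GRing.rterm t & forall e, GRing.eval e t = g e.

Lemma term_fun_cst c : term_fun (fun=> c).
Proof. by exists (GRing.Const c). Qed.

Lemma term_fun_var i : term_fun (fun e => e`_i).
Proof. by exists (GRing.Var R i). Qed.

Lemma term_fun_add g h : term_fun g -> term_fun h -> term_fun (fun e => g e + h e).
Proof.
move=> [t rt tE] [s rs sE]; exists (GRing.Add t s); rewrite /= ?rt // => e.
by rewrite tE sE.
Qed.

Lemma term_fun_mul g h : term_fun g -> term_fun h -> term_fun (fun e => g e * h e).
Proof.
move=> [t rt tE] [s rs sE]; exists (GRing.Mul t s); rewrite /= ?rt // => e.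
by rewrite tE sE.
Qed.

Lemma term_fun_opp g : term_fun g -> term_fun (fun e => - g e).
Proof. by move=> [t rt tE]; exists (GRing.Opp t) => //= e; rewrite tE. Qed.

Lemma term_fun_sum (I : Type) (r : seq I) (G : I -> seq R -> R) :
  (forall i, term_fun (G i)) -> term_fun (fun e => \sum_(i <- r) G i e).
Proof.
move=> HG; elim: r => [|i r IH].
  by have [t rt tE] := term_fun_cst 0; exists t => // e; rewrite big_nil.
have [t rt tE] := term_fun_add (HG i) IH.
by exists t => // e; rewrite big_cons tE.
Qed.

Lemma term_fun_prod (I : Type) (r : seq I) (G : I -> seq R -> R) :
  (forall i, term_fun (G i)) -> term_fun (fun e => \prod_(i <- r) G i e).
Proof.
move=> HG; elim: r => [|i r IH].
  by have [t rt tE] := term_fun_cst 1; exists t => // e; rewrite big_nil.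
have [t rt tE] := term_fun_mul (HG i) IH.
by exists t => // e; rewrite big_cons tE.
Qed.

Lemma definable_ext P Q : (forall e, P e <-> Q e) -> definable P -> definable Q.
Proof. by move=> PQ [f rf fP]; exists f => // e; rewrite fP. Qed.

Lemma definable_true : definable (fun _ : seq R => True).
Proof. by exists (ord.Bool true). Qed.

Lemma definable_le g h : term_fun g -> term_fun h -> definable (fun e => g e <= h e).
Proof.
move=> [t rt tE] [s rs sE]; exists (ord.Le t s); rewrite /= ?rt // => e.
by rewrite tE sE.
Qed.

Lemma definable_lt g h : term_fun g -> term_fun h -> definable (fun e => g e < h e).
Proof.
move=> [t rt tE] [s rs sE]; exists (ord.Lt t s); rewrite /= ?rt // => e.
by rewrite tE sE.
Qed.

Lemma definable_eq g h : term_fun g -> term_fun h -> definable (fun e => g e = h e).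
Proof.
move=> [t rt tE] [s rs sE]; exists (ord.Equal t s); rewrite /= ?rt // => e.
by rewrite tE sE.
Qed.

Lemma definable_and P Q : definable P -> definable Q -> definable (fun e => P e /\ Q e).
Proof.
move=> [f rf fP] [g rg gQ]; exists (ord.And f g); rewrite /= ?rf // => e.
by rewrite fP gQ.
Qed.

Lemma definable_imp P Q : definable P -> definable Q -> definable (fun e => P e -> Q e).
Proof.
move=> [f rf fP] [g rg gQ]; exists (ord.Implies f g); rewrite /= ?rf // => e.
by rewrite fP gQ.
Qed.

Lemma definable_not P : definable P -> definable (fun e => ~ P e).
Proof. by move=> [f rf fP]; exists (ord.Not f) => // e /=; rewrite fP. Qed.

Lemma definable_ex i P :
  definable P -> definable (fun e => exists z, P (set_nth 0 e i z)).
Proof.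
move=> [f rf fP]; exists (ord.Exists i f) => // e /=.
by split=> -[z /fP Hz]; exists z.
Qed.

Lemma definable_forall_fin (I : finType) (D : I -> seq R -> Prop) :
  (forall i, definable (D i)) -> definable (fun e => forall i, D i e).
Proof.
move=> HD; have H (r : seq I) : definable (fun e => forall i, i \in r -> D i e).
  elim: r => [|i r IH]; first by apply: definable_ext definable_true.
  apply: definable_ext (definable_and (HD i) IH) => e; split.
    by move=> [h1 h2] j; rewrite inE => /orP[/eqP ->|/h2].
  by move=> h; split=> [|j jr]; apply: h; rewrite inE ?eqxx ?jr ?orbT.
apply: definable_ext (H (enum I)) => e; split=> h i; first by apply: h; rewrite mem_enum.
by move=> _; apply: h.
Qed.

Definition env_row n (e : seq R) (K : nat) : 'rV[R]_n := \row_(i < n) e`_(K + i).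

Lemma term_fun_env_row n K (i : 'I_n) : term_fun (fun e => env_row n e K 0 i).
Proof.
have [t rt tE] := term_fun_var (K + i)%N.
by exists t => // e; rewrite tE mxE.
Qed.

Lemma definable_ex_seq n K P : definable P ->
  definable (fun e => exists2 s : nat -> R,
     P (foldr (fun i e' => set_nth 0 e' i (s i)) e (iota K n)) & True).
Proof.
elim: n K P => [|n IH] K P HP /=.
  by apply: definable_ext HP => e; split=> [h|[]//]; exists (fun=> 0).
apply: definable_ext (IH K.+1 _ (definable_ex K HP)) => e; split.
  move=> [s [z Hz] _]; exists (fun i => if i == K then z else s i) => //.
  rewrite eqxx; congr P: Hz; congr set_nth.
  have : K \notin iota K.+1 n by rewrite mem_iota ltnn.
  elim: (iota _ _) => //= i r IHr; rewrite inE negb_or => /andP[/negPf Ki /IHr ->].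
  by rewrite eq_sym Ki.
by move=> [s Hs _]; exists s => //; exists (s K).
Qed.

(** The second hypothesis says that [Q] reads only the variables below [K]; overwriting the block
    from [K] on by the coordinates of a witness then leaves [Q] unaffected. *)
Lemma definable_ex_row n K (Q : seq R -> 'rV[R]_n -> Prop) :
  definable (fun e => Q e (env_row n e K)) ->
  (forall e e' x, (forall j, (j < K)%N -> e`_j = e'`_j) -> Q e x -> Q e' x) ->
  definable (fun e => exists x, Q e x).
Proof.
move=> HQ loc; apply: definable_ext (definable_ex_seq n K HQ) => e.
have nthE s r j : (foldr (fun i e' => set_nth 0 e' i (s i)) e r)`_j =
    if j \in r then s j else e`_j.
  elim: r => //= i r IHr; rewrite nth_set_nth /= IHr inE.
  by case: eqVneq => [->|].
split.
  move=> [s Hs _]; exists (env_row n (foldr (fun i e' => set_nth 0 e' i (s i)) e (iota K n)) K).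
  apply: loc Hs => j jK; rewrite nthE mem_iota leqNgt jK //=.
move=> [x Hx].
pose s i : R := if insub (i - K)%N is Some k then x 0 k else 0.
exists s => //.
have -> : env_row n (foldr (fun i e' => set_nth 0 e' i (s i)) e (iota K n)) K = x.
  apply/rowP => i; rewrite mxE nthE mem_iota leq_addr ltn_add2l ltn_ord /s addKn.
  by rewrite insubT //= => h; congr (x _ _); apply: val_inj.
by apply: loc Hx => j jK; rewrite nthE mem_iota leqNgt jK //=.
Qed.

Lemma definable_all_row n K (Q : seq R -> 'rV[R]_n -> Prop) :
  definable (fun e => Q e (env_row n e K)) ->
  (forall e e' x, (forall j, (j < K)%N -> e`_j = e'`_j) -> Q e x -> Q e' x) ->
  definable (fun e => forall x, Q e x).
Proof.
move=> HQ loc.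
have H := @definable_ex_row n K (fun e x => ~ Q e x) (definable_not HQ).
apply: definable_ext (definable_not (H _)) => [e|e e' x ee' nQ Qx].
  split=> [h x|h [x]]; last by apply.
  by apply: contrapT => Qx; apply: h; exists x.
by apply: nQ; apply: loc Qx => j jK; rewrite ee'.
Qed.

(** Every offset [K] is allowed because a formula may hold several points, each in a block of its
    own. *)
Definition row_polynomial n (g : 'rV[R]_n -> R) :=
  forall K, term_fun (fun e => g (env_row n e K)).

End Definability.

(** * Total variation and level crossings *)

Section Variation.
Variable R : realType.

(** The sum is [h] times the ceiling of [x / h]. *)
Lemma grid_count (h x : R) (L : nat) : 0 < h -> 0 <= x -> x <= L%:R * h ->
  x <= \sum_(l < L) (l%:R * h < x)%R%:R * h <= x + h.
Proof.
move=> h0 x0; elim: L => [|L IH] xL; first by rewrite big_ord0; lra.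
rewrite big_ord_recr /=; have [xL'|xL'] := leP x (L%:R * h).
  by rewrite mul0r addr0 IH.
rewrite mul1r (eq_bigr (fun=> h)) => [|l _].
  rewrite sumr_const card_ord -mulr_natl; move: xL; rewrite -natr1; lra.
rewrite (le_lt_trans _ xL') ?mul1r // ler_wpM2r ?(ltW h0) // ler_nat.
exact/ltnW/ltn_ord.
Qed.

(* A discrete Banach indicatrix argument: the total variation of [u] is the
   integral over the levels [c] of the number of crossings of [c]. *)
Lemma grid_variation_le (u : nat -> R) (M : R) (N K : nat) : 0 < M ->
  (forall k, (k <= K)%N -> `|u k| <= M) ->
  (forall c, (changes (fun k => c < u k)%R K <= N)%N) ->
  \sum_(k < K) `|u k.+1 - u k| <= 2 * M * (N%:R + 1).
Proof.
move=> M0 uM uN; have [->|K0] := posnP K.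
  by rewrite big_ord0; have := ler0n R N; nra.
have KR : 0 < K%:R :> R by rewrite ltr0n.
(* With this mesh the [K] levels span [[-M, M]], and the [K] rounding errors of size [h] add up to
   just [2 * M]. *)
pose h := 2 * M / K%:R; have h0 : 0 < h by rewrite divr_gt0 // mulr_gt0.
have Kh : K%:R * h = 2 * M by rewrite /h mulrC divfK // gt_eqF.
pose cnt x := \sum_(l < K) (l%:R * h < x + M)%R%:R * h.
have cntP k : (k <= K)%N -> u k + M <= cnt (u k) <= u k + M + h.
  by move=> kK; have := uM k kK; rewrite ler_norml => /andP[a b]; apply: grid_count => //; lra.
have step (k : 'I_K) : `|u k.+1 - u k| <=
    \sum_(l < K) ((l%:R * h - M < u k) (+) (l%:R * h - M < u k.+1))%R%:R * h + h.
  have : `|cnt (u k.+1) - cnt (u k)| <=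
    \sum_(l < K) ((l%:R * h - M < u k) (+) (l%:R * h - M < u k.+1))%R%:R * h.
    rewrite /cnt -sumrB; apply: le_trans (ler_norm_sum _ _ _) _.
    apply: ler_sum => l _; rewrite -mulrBl normrM (gtr0_norm h0) ler_pM2r //.
    by rewrite !ltrBlDr; do 2 case: (_ < _); rewrite /= ?subrr ?normr0 ?subr0 ?sub0r ?normrN ?normr1.
  have /andP[a1 a2] := cntP k (ltnW (ltn_ord k)).
  have /andP[b1 b2] := cntP k.+1 (ltn_ord k).
  rewrite ler_norml => /andP[c1 c2]; rewrite ler_norml; apply/andP; split; lra.
apply: le_trans (ler_sum _ (fun k _ => step k)) _.
have sumh : \sum_(k < K) h = 2 * M by rewrite sumr_const card_ord -[h *+ K]mulr_natl.
rewrite big_split /= sumh exchange_big /=.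
have -> : 2 * M * (N%:R + 1) = K%:R * (N%:R * h) + 2 * M.
  by rewrite mulrCA Kh; ring.
rewrite lerD2r -[K in leRHS]card_ord mulr_natl -sumr_const; apply: ler_sum => l _.
rewrite -mulr_suml ler_wpM2r ?(ltW h0) // -natr_sum ler_nat.
exact: (uN (l%:R * h - M)).
Qed.

End Variation.

(** * Lexicographically least points of compact sets *)

Section LexMin.
Variables (R : realType) (n : nat).
Implicit Types (Z : set 'rV[R]_n) (x y : 'rV[R]_n).

(** A canonical choice of a point of [Z] that a first-order formula can express; it provides the
    definable selection. *)
Definition lexmin Z x := Z x /\ forall y, Z y ->
  forall j : 'I_n, (forall i : 'I_n, (i < j)%N -> x 0 i = y 0 i) -> x 0 j <= y 0 j.

Lemma lexmin_unique Z x y : lexmin Z x -> lexmin Z y -> x = y.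
Proof.
move=> [Zx Hx] [Zy Hy]; apply/rowP => j.
have H k : forall i : 'I_n, (i < k)%N -> x 0 i = y 0 i.
  elim: k => [//|k IH] i; rewrite ltnS leq_eqVlt => /orP[/eqP ik|]; last exact: IH.
  apply: le_anti; apply/andP; split; [apply: Hx|apply: Hy] => // l; rewrite ik => /IH //.
exact: (H n).
Qed.

Lemma closed_preimage_eq (g : 'rV[R]_n -> R) c : continuous g -> closed [set x | g x = c].
Proof.
move=> cg; apply: (@closed_comp _ _ g [set z | z = c]) => [x _|]; [exact: cg|exact: closed_eq].
Qed.

Lemma closed_preimage_le (g : 'rV[R]_n -> R) c : continuous g -> closed [set x | g x <= c].
Proof.
move=> cg; apply: (@closed_comp _ _ g [set z | z <= c]) => [x _|]; [exact: cg|exact: closed_le].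
Qed.

Lemma closed_forall (I : Type) (D : I -> set 'rV[R]_n) :
  (forall i, closed (D i)) -> closed [set x | forall i, D i x].
Proof.
move=> HD; have -> : [set x | forall i, D i x] = \bigcap_(i in [set: I]) D i.
  by apply/seteqP; split=> x /= h i; [move=> _; apply: h|apply: h].
by apply: closed_bigI => i _; apply: HD.
Qed.

Lemma compact_box Z M : closed Z -> (forall x i, Z x -> `|x 0 i| <= M) -> compact Z.
Proof.
move=> Zcl ZM.
have cbox : compact [set v : 'rV[R]_n | forall i, v ord0 i \in `[-M, M]].
  apply: (@rV_compact _  _ (fun=> `[- M, M]%classic)).
  by move=> _; apply: segment_compact.
by apply: subclosed_compact Zcl cbox _ => v Zv i; rewrite in_itv /= -ler_norml ZM.
Qed.

(** Coordinates are minimised one at a time, each over the compact set of points that agree with the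
    previous minimiser in all earlier coordinates. *)
Lemma lexmin_exists Z : compact Z -> closed Z -> Z !=set0 -> exists x, lexmin Z x.
Proof.
move=> Zco Zcl Z0.
suff H k : exists x, Z x /\ forall y, Z y ->
  forall j : 'I_n, (j < k)%N -> (forall i : 'I_n, (i < j)%N -> x 0 i = y 0 i) -> x 0 j <= y 0 j.
  by have [x [Zx Hx]] := H n; exists x; split=> // y Zy j; apply: Hx.
elim: k => [|k [x [Zx Hx]]]; first by case: Z0 => x Zx; exists x.
have [nk|kn] := leqP n k.
  by exists x; split=> // y Zy j _; apply: Hx => //; apply: leq_trans nk.
pose Z' := Z `&` [set y | forall i : 'I_n, (i < k)%N -> y 0 i = x 0 i].
have Z'co : compact Z'.
  apply: compact_closedI => //; apply: closed_forall => i.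
  have [ik|ik] := boolP (i < k)%N; last first.
    rewrite (_ : (fun _ => _) = setT); first exact: closedT.
    by apply/seteqP; split.
  have := @closed_preimage_eq _ (x 0 i) (@coord_continuous R 1 n 0 i).
  congr closed; apply/seteqP; split=> y //=; exact.
have Z'0 : Z' !=set0 by exists x.
have cj : {within Z', continuous (fun y : 'rV[R]_n => y 0 (Ordinal kn))}.
  by apply: continuous_subspaceT; exact: coord_continuous.
have [z] := EVT_min_rV Z'0 Z'co cj.
rewrite inE => -[Zz zx] zmin; exists z; split=> // y Zy j.
rewrite ltnS leq_eqVlt => /orP[/eqP jk|jk] zy.
  have -> : j = Ordinal kn by apply: val_inj.
  apply: zmin; rewrite inE; split=> // i ik /=; rewrite -zy ?zx //.
  by rewrite jk.
rewrite zx //; apply: Hx => // i ij; rewrite -zy // zx //.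
exact: ltn_trans jk.
Qed.

End LexMin.

(** * A Lojasiewicz type inequality *)

Section GermAtZero.
Variable R : realType.

(** If the failure of [P] accumulated at 0 as well, truth and failure would alternate along a
    decreasing sequence more than [N] times. *)
Lemma definable_germ_at_zero (P : seq R -> Prop) (e : seq R) : definable P ->
  (forall t0, 0 < t0 -> exists2 t, 0 < t < t0 & P (at0 e t)) ->
  exists2 t1 : R, 0 < t1 & forall t, 0 < t <= t1 -> P (at0 e t).
Proof.
move=> /definable_changes[N HN] acc; apply: contrapT => nP.
have nacc t0 : 0 < t0 -> exists2 t, 0 < t < t0 & ~ P (at0 e t).
  move=> t0p; apply: contrapT => H; apply: nP; exists (t0 / 2); first lra.
  move=> t tb; apply: contrapT => Pt; apply: H; exists t => //; lra.
have nxtP (p : bool * R) : exists t, 0 < p.2 -> 0 < t < p.2 /\ (P (at0 e t) <-> p.1).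
  case: p => b s /=; have [s0|_] := boolP (0 < s); last by exists 0.
  case: b; [have [t ts Pt] := acc s s0|have [t ts Pt] := nacc s s0]; exists t => _; split=> //.
have [nxt {}nxtP] := choice nxtP.
pose sig := fix f k := if k is k'.+1 then nxt (odd k', f k') else 1.
have sig0 k : 0 < sig k.
  elim: k => [|k IH] /=; first exact: ltr01.
  by have [/andP[]] := nxtP (odd k, sig k) IH.
have sigS k : sig k.+1 < sig k.
  by have [/andP[]] := nxtP (odd k, sig k) (sig0 k).
have sigP k : P (at0 e (sig k.+1)) <-> odd k.
  by have [_] := nxtP (odd k, sig k) (sig0 k).
have sigl i j : (i < j)%N -> sig j < sig i.
  elim: j => // j IH; rewrite ltnS leq_eqVlt => /orP[/eqP -> //|/IH].
  exact/lt_trans/sigS.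
pose K := N.+1.
(* The sequence is read backwards, from index [K.+1] down to 1. The starting point [sig 0] is left
   out, because the truth value there is not prescribed. *)
have /HN : increasing_upto (fun k => sig (K.+1 - k)%N) K.
  by move=> i j ij; apply: sigl; lia.
move=> /(_ e); rewrite leqNgt => /negP; apply.
rewrite /changes (eq_bigr (fun=> 1%N)) ?sum1_card ?card_ord // => k _.
have kN : (k <= N)%N by rewrite -ltnS.
have a : (K.+1 - k = (K - k).+1)%N by rewrite subSn // ltnW.
have b : (K.+1 - k.+1 = (N - k).+1)%N by rewrite subSS /K subSn.
have c : (K - k = (N - k).+1)%N by rewrite /K subSn.
rewrite a b c.
have -> : `[< P (at0 e (sig (N - k).+2)) >] = ~~ odd (N - k).
  by apply/asboolP/idP; rewrite sigP.
have -> : `[< P (at0 e (sig (N - k).+1)) >] = odd (N - k).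
  by apply/asboolP/idP; rewrite sigP.
by case: odd.
Qed.

End GermAtZero.

Section Lojasiewicz.
Variables (R : realType) (n p : nat).
Variables (h g : 'rV[R]_n -> R) (F : 'I_p -> 'rV[R]_n -> R) (M C : R).
Hypotheses (ph : row_polynomial h) (pg : row_polynomial g).
Hypothesis (pF : forall i, row_polynomial (F i)).
Hypotheses (ch : continuous h) (cg : continuous g) (cF : forall i, continuous (F i)).
Hypothesis (M0 : 0 < M) (C0 : 0 < C).
Hypothesis (bnd : forall x i, h x = 0 -> `|x 0 i| <= M).
(** [F] plays the role of the gradient of [g] along the set [h = 0], and [delta ^+ 2] covers the
    second order terms. *)
Hypothesis lip : forall x x' (eta delta : R), h x = 0 -> h x' = 0 ->
  0 <= eta -> 0 <= delta ->
  (forall i, `|F i x| <= eta) -> (forall i, `|x' 0 i - x 0 i| <= delta) ->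
  `|g x' - g x| <= C * (eta * delta + delta ^+ 2).

(* In the formulas below, variable 0 is the level [t], variable 1 a bound for a
   coordinate and variable 2 is [eps]; the coordinates of points are the variables
   from 3 and from [3 + n] on. *)
Let zset (t eps : R) : set 'rV[R]_n :=
  [set x | h x = 0 /\ (g x = t /\ forall i, F i x <= eps * t /\ - F i x <= eps * t)].

Let closed_zset t eps : closed (zset t eps).
Proof.
apply: closedI; first exact: closed_preimage_eq.
apply: closedI; first exact: closed_preimage_eq.
apply: closed_forall => i; apply: closedI; first exact: closed_preimage_le.
by apply: closed_preimage_le => x; apply: continuousN; apply: cF.
Qed.

Let compact_zset t eps : compact (zset t eps).
Proof. by apply: (@compact_box _ _ _ M) => [|x i [hx _]]; [exact: closed_zset|exact: bnd]. Qed.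

Let definable_zset K : definable (fun e : seq R => zset e`_0 e`_2 (env_row n e K)).
Proof.
have t02 : term_fun (fun e : seq R => e`_2 * e`_0).
  by apply: term_fun_mul; apply: term_fun_var.
apply: definable_and; first by apply: definable_eq (ph K) (term_fun_cst 0).
apply: definable_and; first by apply: definable_eq (pg K) (term_fun_var R 0).
apply: definable_forall_fin => i; apply: definable_and.
  exact: definable_le (pF i K) t02.
exact: definable_le (term_fun_opp (pF i K)) t02.
Qed.

Let definable_nonempty : definable (fun e : seq R => exists x, zset e`_0 e`_2 x).
Proof.
apply: (@definable_ex_row _ _ 3 (fun e : seq R => zset e`_0 e`_2)); first exact: definable_zset.
by move=> e e' x ee'; rewrite !ee'.
Qed.

Let definable_lexmin (i : 'I_n) :
  definable (fun e : seq R => exists x, lexmin (zset e`_0 e`_2) x /\ e`_1 < x 0 i).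
Proof.
apply: (@definable_ex_row _ _ 3
  (fun (e : seq R) x => lexmin (zset e`_0 e`_2) x /\ e`_1 < x 0 i)); last first.
  by move=> e e' x ee'; rewrite !ee'.
apply: definable_and; last exact: definable_lt (term_fun_var R 1) (term_fun_env_row R 3 i).
apply: definable_and; first exact: definable_zset.
apply: (@definable_all_row _ _ (3 + n) (fun (e : seq R) y => zset e`_0 e`_2 y ->
  forall j : 'I_n, (forall i : 'I_n, (i < j)%N -> env_row n e 3 0 i = y 0 i) ->
    env_row n e 3 0 j <= y 0 j)); last first.
  move=> e e' y ee'; rewrite !ee' //.
  suff -> : env_row n e 3 = env_row n e' 3 by [].
  by apply/rowP => j; rewrite !mxE ee' // ltn_add2l.
apply: definable_imp; first exact: definable_zset.
apply: definable_forall_fin => j; apply: definable_imp; last first.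
  exact: definable_le (term_fun_env_row R 3 j) (term_fun_env_row R (3 + n) j).
apply: definable_forall_fin => k.
(* The index condition does not involve the assignment, so it is decided before the formula is
   built. *)
have [kj|kj] := boolP (k < j)%N; last first.
  by apply: definable_ext (definable_true R) => e; split.
apply: definable_ext (definable_eq (term_fun_env_row R 3 k) (term_fun_env_row R (3 + n) k)) => e.
by split=> // H; apply: H.
Qed.

(* Otherwise near-critical points at all small levels [t] could be selected by a
   definable, hence bounded variation, curve; along it [g] grows at rate
   [eps * t] only, and cannot climb from [t1 / 2] to [t1]. *)
Lemma lojasiewicz : exists2 eps, 0 < eps & exists2 t0 : R, 0 < t0 &
  forall x, h x = 0 -> 0 < g x < t0 -> exists i, eps * g x < `|F i x|.
Proof.
have Nex (i : 'I_n) : exists N, forall e tau K, increasing_upto tau K -> (changes (fun k =>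
    `[< exists x, lexmin (zset (at0 e (tau k))`_0 (at0 e (tau k))`_2) x /\
         (at0 e (tau k))`_1 < x 0 i >]%R) K <= N)%N.
  exact: definable_changes (definable_lexmin i).
have [Nf {}Nex] := choice Nex.
(* [V] will bound the variation of the selected curve. The counts [Nf i] hold for all values of
   variable 2, so [V] is known before [eps] is chosen. *)
pose V := \sum_(i < n) 2 * M * ((Nf i)%:R + 1).
have V0 : 0 <= V.
  apply: sumr_ge0 => i _; have := ler0n R (Nf i); have := M0; nra.
(* This gives [C * eps * V <= 1 / 8]: along the curve [g] climbs at most
   [2 * C * (eps * t1) * V <= t1 / 4], short of the required [t1 / 2]. *)
pose eps := (8 * C * (V + 1))^-1.
have eps0 : 0 < eps by rewrite invr_gt0 !mulr_gt0 // ltr_wpDl.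
exists eps => //; apply: contrapT => H.
have acc t0 : 0 < t0 -> exists2 t, 0 < t < t0 & exists x, zset t eps x.
  move=> t00; apply: contrapT => H'; apply: H; exists t0 => // x hx gx.
  apply: contrapT => Fx; apply: H'; exists (g x) => //; exists x; split=> //; split=> // i.
  have : `|F i x| <= eps * g x by rewrite leNgt; apply/negP => ?; apply: Fx; exists i.
  by rewrite ler_norml => /andP[a b]; split=> //; rewrite lerNl.
(* Near-critical points exist at arbitrarily small levels; by definability they then exist at every
   level up to some [t1]. *)
have [t1 t10 ne] : exists2 t1 : R, 0 < t1 & forall t, 0 < t <= t1 -> exists x, zset t eps x.
  have [t0 t00|t1 t10 ne] := @definable_germ_at_zero _ _ [:: 0; 0; eps] definable_nonempty.
    by have [t ? ?] := acc t0 t00; exists t.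
  by exists t1 => // t /ne.
have lexP t : exists x, 0 < t <= t1 -> lexmin (zset t eps) x.
  have [tt|] := boolP (0 < t <= t1); last by exists 0.
  by have [||x lx] := lexmin_exists (@compact_zset t eps); [exact: closed_zset|exact: ne|exists x].
have [xs {}lexP] := choice lexP.
(* [K] is large enough for one step of the grid to be smaller than the
   quadratic threshold [2 * C * (eps * t1) ^ 2] *)
pose K := (Num.truncn (t1 / 2 / (2 * C * (eps * t1) ^+ 2))).+1.
have K0 : 0 < K%:R :> R by rewrite ltr0n.
pose s := t1 / 2 / K%:R.
have s0 : 0 < s by rewrite !divr_gt0.
have sK : K%:R * s = t1 / 2 by rewrite /s mulrC divfK // gt_eqF.
have e0 : 0 < 2 * C * (eps * t1) ^+ 2 by rewrite !mulr_gt0 // exprn_gt0 // mulr_gt0.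
have s_small : s <= 2 * C * (eps * t1) ^+ 2.
  rewrite /s ler_pdivrMr // [leRHS]mulrC -ler_pdivrMr //.
  exact/ltW/truncnS_gt.
pose tau (k : nat) := t1 / 2 + k%:R * s.
have tau_in k : (k <= K)%N -> 0 < tau k <= t1.
  move=> kK; have : k%:R * s <= K%:R * s by rewrite ler_pM2r // ler_nat.
  have : 0 <= k%:R * s by rewrite mulr_ge0 // ltW.
  rewrite /tau sK; lra.
have tau_inc : increasing_upto tau K.
  by move=> i j /andP[ij _]; rewrite /tau ltrD2l ltr_pM2r // ltr_nat.
pose x k := xs (tau k).
have xP k : (k <= K)%N -> lexmin (zset (tau k) eps) (x k) by move=> /tau_in /lexP.
have xz k : (k <= K)%N -> zset (tau k) eps (x k) by move=> /xP [].
have var (i : 'I_n) : \sum_(k < K) `|x k.+1 0 i - x k 0 i| <= 2 * M * ((Nf i)%:R + 1).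
  pose u (k : nat) : R := x k 0 i.
  apply: (@grid_variation_le R u M (Nf i) K M0) => [k kK|c].
    by have [hx _] := xz k kK; apply: bnd.
  rewrite /=; apply: leq_trans (Nex i [:: 0; c; eps] _ _ tau_inc); rewrite eq_leq //.
  apply: eq_bigr => k _.
  suff E l : (l <= K)%N -> (c < x l 0 i) =
     `[< exists y, lexmin (zset (tau l) eps) y /\ c < y 0 i >].
    by rewrite /= !E // ltnW.
  move=> lK; apply/idP/asboolP => [cx|[y [ly cy]]]; first by exists (x l); split=> //; apply: xP.
  by rewrite (lexmin_unique (xP l lK) ly).
have step (k : 'I_K) : s <= 2 * C * (eps * t1) * \sum_(i < n) `|x k.+1 0 i - x k 0 i|.
  set d := \sum_(i < n) _.
  have d0 : 0 <= d by apply: sumr_ge0.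
  have [hx [gx Fx]] := xz k (ltnW (ltn_ord k)).
  have [hx' [gx' _]] := xz k.+1 (ltn_ord k).
  have et0 : 0 <= eps * t1 by rewrite mulr_ge0 // ltW.
  have := lip hx hx' et0 d0.
  rewrite gx gx' /tau opprD addrACA subrr add0r -mulrBl -natr1 [_ + 1]addrC addrK mul1r gtr0_norm //.
  case/(_ _ _)/wrap => [i|i|].
  - have /andP[_ tk] := tau_in k (ltnW (ltn_ord k)).
    have : eps * tau k <= eps * t1 by rewrite ler_pM2l.
    by have [a b] := Fx i; rewrite ler_norml; lra.
  - by rewrite /d (bigD1 i) //= lerDl sumr_ge0.
  (* For small [d] the quadratic term is absorbed by the linear one. For large [d] the right side
     already exceeds the threshold that bounds the grid step [s]. *)
  have [de|de] := leP d (eps * t1) => H1.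
    have : d ^+ 2 <= eps * t1 * d by rewrite expr2 ler_wpM2r.
    have := C0; nra.
  apply: le_trans s_small _.
  have -> : 2 * C * (eps * t1) ^+ 2 = 2 * C * (eps * t1) * (eps * t1) by ring.
  rewrite ler_pM2l ?ltW //.
  by rewrite !mulr_gt0.
have : \sum_(k < K) s <= 2 * C * (eps * t1) * V.
  apply: le_trans (ler_sum _ (fun k _ => step k)) _.
  rewrite -mulr_sumr ler_wpM2l //; first by rewrite !mulr_ge0 // ltW.
  rewrite exchange_big /=; apply: ler_sum => i _; exact: var.
rewrite sumr_const card_ord -[s *+ K]mulr_natl sK => H1.
have epsE : 8 * (C * eps * (V + 1)) = 1.
  rewrite -[RHS](@mulVf _ (8 * C * (V + 1))); first by rewrite /eps; ring.
  by rewrite gt_eqF // !mulr_gt0 // ltr_wpDl.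
have H2 : C * eps * V <= 1 / 8.
  have : 0 < C * eps by rewrite mulr_gt0.
  lra.
have : (C * eps * V) * t1 <= 1 / 8 * t1 by rewrite ler_pM2r.
lra.
Qed.

End Lojasiewicz.

(** * Tensor forms *)

Section PolynomialMaps.
Variables (R : realType) (n : nat).
Implicit Types (g h : 'rV[R]_n -> R) (x : 'rV[R]_n).

(** The bound on [g] itself is included to make the class stable under products. *)
Definition loc_lipschitz g := forall M : R, exists2 C : R, 0 < C &
  (forall x, (forall i, `|x 0 i| <= M) -> `|g x| <= C) /\
  (forall x x' (delta : R), (forall i, `|x 0 i| <= M) -> (forall i, `|x' 0 i| <= M) ->
     0 <= delta -> (forall i, `|x' 0 i - x 0 i| <= delta) -> `|g x' - g x| <= C * delta).

Let regular g := continuous g /\ loc_lipschitz g.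

Let regular_cst c : regular (fun=> c).
Proof.
split; first exact: cst_continuous.
move=> M; exists (`|c| + 1); first by rewrite ltr_wpDl.
split=> [x _|x x' delta _ _ d0 _]; first by rewrite lerDl.
by rewrite subrr normr0 mulr_ge0 // addr_ge0.
Qed.

Let regular_coord i : regular (fun x => x 0 i).
Proof.
split; first exact: coord_continuous.
move=> M; exists (`|M| + 1); first by rewrite ltr_wpDl.
split=> [x xM|x x' delta xM _ d0 xx'].
  by apply: le_trans (xM i) _; apply: le_trans (ler_norm _) _; rewrite lerDl.
by apply: le_trans (xx' i) _; rewrite ler_peMl // lerDr.
Qed.

Let regular_add g h : regular g -> regular h -> regular (fun x => g x + h x).
Proof.
move=> [cg lg] [chh lh]; split; first by move=> x; apply: continuousD; [exact: cg|exact: chh].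
move=> M; have [C C0 [b l]] := lg M; have [C' C'0 [b' l']] := lh M.
exists (C + C'); first exact: addr_gt0.
split=> [x xM|x x' delta xM x'M d0 xx'].
  by apply: le_trans (ler_normD _ _) _; rewrite lerD ?b ?b'.
have -> : g x' + h x' - (g x + h x) = (g x' - g x) + (h x' - h x) by ring.
by apply: le_trans (ler_normD _ _) _; rewrite mulrDl lerD ?l ?l'.
Qed.

Let regular_mul g h : regular g -> regular h -> regular (fun x => g x * h x).
Proof.
move=> [cg lg] [chh lh]; split; first by move=> x; apply: continuousM; [exact: cg|exact: chh].
move=> M; have [C C0 [b l]] := lg M; have [C' C'0 [b' l']] := lh M.
exists (2 * C * C'); first by rewrite !mulr_gt0.
split=> [x xM|x x' delta xM x'M d0 xx'].
  rewrite normrM; have := ler_pM (normr_ge0 _) (normr_ge0 _) (b x xM) (b' x xM).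
  have := mulr_gt0 C0 C'0; lra.
have -> : g x' * h x' - g x * h x = (g x' - g x) * h x' + g x * (h x' - h x) by ring.
apply: le_trans (ler_normD _ _) _; rewrite !normrM.
have H1 := ler_pM (normr_ge0 _) (normr_ge0 _) (l _ _ _ xM x'M d0 xx') (b' x' x'M).
have H2 := ler_pM (normr_ge0 _) (normr_ge0 _) (b x xM) (l' _ _ _ xM x'M d0 xx').
apply: le_trans (lerD H1 H2) _; lra.
Qed.

Let row_env x := [seq x 0 i | i <- enum 'I_n].

Let row_envE x : env_row n (row_env x) 0 = x.
Proof.
apply/rowP => i; rewrite mxE add0n (nth_map i) ?size_enum_ord //.
by rewrite nth_ord_enum.
Qed.

Let regular_eval (t : GRing.term R) : GRing.rterm t ->
  regular (fun x => GRing.eval (row_env x) t).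
Proof.
elim: t => /=.
- move=> j _; have [jn|nj] := ltnP j n.
    rewrite (_ : (fun x => _) = (fun x => x 0 (Ordinal jn))); first exact: regular_coord.
    apply/funext => x; rewrite -[in RHS](row_envE x) mxE //.
  rewrite (_ : (fun x => _) = (fun=> 0)); first exact: regular_cst.
  by apply/funext => x; rewrite nth_default // size_map size_enum_ord.
- by move=> r _; exact: (regular_cst r).
- by move=> k _; exact: (regular_cst k%:R).
- by move=> t1 I1 t2 I2 /andP[/I1 h1 /I2 h2]; apply: regular_add.
- move=> t I /I h; rewrite (_ : (fun x => _) = (fun x => -1 * GRing.eval (row_env x) t)).
    by apply: regular_mul => //; apply: regular_cst.
  by apply/funext => x; rewrite mulN1r.
- move=> t I k /I h; rewrite (_ : (fun x => _) = (fun x => k%:R * GRing.eval (row_env x) t)).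
    by apply: regular_mul => //; apply: regular_cst.
  by apply/funext => x; rewrite mulr_natl.
- by move=> t1 I1 t2 I2 /andP[/I1 h1 /I2 h2]; apply: regular_mul.
- by [].
- move=> t I k /I h; elim: k => [|k IH].
    rewrite (_ : (fun x => _) = (fun=> 1)); first exact: regular_cst.
    by apply/funext => x; rewrite expr0.
  rewrite (_ : (fun x => _) = (fun x => GRing.eval (row_env x) t * GRing.eval (row_env x) t ^+ k)).
    exact: regular_mul.
  by apply/funext => x; rewrite exprS.
Qed.

Lemma row_polynomial_regular g : row_polynomial g -> continuous g /\ loc_lipschitz g.
Proof.
move=> /(_ 0%N) [t rt tE]; have := regular_eval rt.
by rewrite (_ : (fun x => _) = g) //; apply/funext => x; rewrite tE row_envE.
Qed.

Lemma row_polynomial_continuous g : row_polynomial g -> continuous g.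
Proof. by move=> /row_polynomial_regular []. Qed.

End PolynomialMaps.

(** * Inner products and Taylor expansion of tensor forms *)

Section TensorForms.
Variables (R : realType) (n : nat).
Implicit Types (x y z u v : 'rV[R]_n).

Lemma dotvDl u v z : dotv (u + v) z = dotv u z + dotv v z.
Proof. by rewrite /dotv -big_split; apply: eq_bigr => i _; rewrite mxE mulrDl. Qed.

Lemma dotvC u v : dotv u v = dotv v u.
Proof. by apply: eq_bigr => i _; rewrite mulrC. Qed.

Lemma dotvZl c u v : dotv (c *: u) v = c * dotv u v.
Proof. by rewrite /dotv mulr_sumr; apply: eq_bigr => i _; rewrite mxE mulrA. Qed.

Lemma dotvNl u v : dotv (- u) v = - dotv u v.
Proof. by rewrite -scaleN1r dotvZl mulN1r. Qed.

Lemma dotvDr z u v : dotv z (u + v) = dotv z u + dotv z v.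
Proof. by rewrite dotvC dotvDl !(dotvC z). Qed.

Lemma dotvZr c u v : dotv u (c *: v) = c * dotv u v.
Proof. by rewrite dotvC dotvZl dotvC. Qed.

Lemma dotvNr u v : dotv u (- v) = - dotv u v.
Proof. by rewrite dotvC dotvNl dotvC. Qed.

Lemma dotv_le u v (a b : R) : (forall i, `|u 0 i| <= a) -> (forall i, `|v 0 i| <= b) ->
  `|dotv u v| <= n%:R * (a * b).
Proof.
move=> ua vb; apply: le_trans (ler_norm_sum _ _ _) _.
rewrite -[n in leRHS]card_ord mulr_natl -sumr_const; apply: ler_sum => i _.
by rewrite normrM ler_pM.
Qed.

Lemma dotv_ge_sqr u i : u 0 i ^+ 2 <= dotv u u.
Proof.
rewrite /dotv (bigD1 i) //= -expr2 lerDl; apply: sumr_ge0 => j _.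
by rewrite -expr2 sqr_ge0.
Qed.

Lemma enorm_sqr u : enorm u ^+ 2 = dotv u u.
Proof. by rewrite sqr_sqrtr //; apply: sumr_ge0 => j _; rewrite -expr2 sqr_ge0. Qed.

Lemma coord_le_norm u i : `|u 0 i| <= `|u|.
Proof.
rewrite [leRHS]mx_normrE.
exact: (le_bigmax_cond 0 (fun k : 'I_1 * 'I_n => `|u k.1 k.2|) (j := (0, i))).
Qed.

Lemma norm_le_coord u (a : R) : 0 <= a -> (forall i, `|u 0 i| <= a) -> `|u| <= a.
Proof.
move=> a0 H; rewrite [leLHS]mx_normrE; apply/bigmax_leP; split=> // -[j i] _ /=.
by rewrite ord1.
Qed.

Lemma norm_sqr_le_dotv u : `|u| ^+ 2 <= dotv u u.
Proof.
rewrite -enorm_sqr ler_sqr ?nnegrE ?sqrtr_ge0 //; apply: norm_le_coord; first exact: sqrtr_ge0.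
by move=> i; rewrite -sqrtr_sqr ler_wsqrtr // dotv_ge_sqr.
Qed.

Lemma sum_tupleS (V : nmodType) m (G : m.+1.-tuple 'I_n -> V) :
  \sum_(i : m.+1.-tuple 'I_n) G i =
  \sum_(k < n) \sum_(j : m.-tuple 'I_n) G [tuple of k :: j].
Proof.
rewrite pair_big /= (reindex (fun q : 'I_n * m.-tuple 'I_n => [tuple of q.1 :: q.2])) //=.
exists (fun i => (thead i, [tuple of behead i])) => [[k j] _|i _] /=.
  by rewrite theadE; congr pair; apply: val_inj.
by rewrite -tuple_eta.
Qed.

Lemma dotv_tvec m (A : tensor R m.+1 n) x v :
  dotv (tvec A x) v = \sum_(i : m.+1.-tuple 'I_n)
    A i * (v 0 (tnth i ord0) * \prod_(k < m) x 0 (tnth i (lift ord0 k))).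
Proof.
rewrite sum_tupleS /dotv; apply: eq_bigr => k _; rewrite mxE mulr_suml.
apply: eq_bigr => j _; rewrite tnth0 -mulrA [_ * v 0 k]mulrC.
by congr (_ * (_ * _)); apply: eq_bigr => l _; rewrite tnthS.
Qed.

Lemma euler_tform m (A : tensor R m.+1 n) x : dotv (tvec A x) x = tform A x.
Proof. by rewrite dotv_tvec; apply: eq_bigr => i _; rewrite big_ord_recl. Qed.

Lemma tform_scale m (A : tensor R m n) c x : tform A (c *: x) = c ^+ m * tform A x.
Proof.
rewrite /tform mulr_sumr; apply: eq_bigr => i _; rewrite mulrCA; congr (_ * _).
rewrite (eq_bigr (fun k => c * x 0 (tnth i k))) => [|k _]; last by rewrite mxE.
by rewrite big_split /= prodr_const card_ord.
Qed.

Lemma tform_polynomial m (A : tensor R m n) : row_polynomial (tform A).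
Proof.
move=> K; apply: term_fun_sum => i; apply: term_fun_mul; first exact: term_fun_cst.
by apply: term_fun_prod => k; apply: term_fun_env_row.
Qed.

Lemma tvec_polynomial m (A : tensor R m.+1 n) i : row_polynomial (fun x => tvec A x 0 i).
Proof.
move=> K; rewrite /tvec.
rewrite (_ : (fun e => _) = (fun e => \sum_(j : m.-tuple 'I_n)
  A [tuple of i :: j] * \prod_(k < m) env_row n e K 0 (tnth j k))); last first.
  by apply/funext => e; rewrite mxE.
apply: term_fun_sum => j; apply: term_fun_mul; first exact: term_fun_cst.
by apply: term_fun_prod => k; apply: term_fun_env_row.
Qed.

Lemma prod_lift m (a : 'I_m.+1 -> R) (k : 'I_m) :
  \prod_(j < m.+1 | j != lift ord0 k) a j =
  a ord0 * \prod_(j < m | j != k) a (lift ord0 j).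
Proof.
rewrite big_mkcond big_ord_recl /=; congr (_ * _).
by rewrite [RHS]big_mkcond /=; apply: eq_bigr => j _; rewrite (inj_eq lift_inj).
Qed.

Lemma prod_lift0 m (a : 'I_m.+1 -> R) :
  \prod_(j < m.+1 | j != ord0) a j = \prod_(j < m) a (lift ord0 j).
Proof. by rewrite big_mkcond big_ord_recl /= mul1r. Qed.

(** Induction splitting off the first factor. The second order estimate for [m.+1] factors uses the
    first order one for [m], so both are proved together. *)
Lemma prod_taylor m (M : R) : 0 < M -> exists2 C : R, 0 < C &
  forall (a b : 'I_m -> R) (delta : R), 0 <= delta ->
   (forall k, `|a k| <= M) -> (forall k, `|b k| <= M) -> (forall k, `|b k - a k| <= delta) ->
   `|\prod_(k < m) b k - \prod_(k < m) a k| <= C * delta /\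
   `|\prod_(k < m) b k - \prod_(k < m) a k -
     \sum_(k < m) (b k - a k) * \prod_(j < m | j != k) a j| <= C * delta ^+ 2.
Proof.
move=> M0; elim: m => [|m [C C0 IH]].
  exists 1 => // a b delta d0 _ _ _; rewrite !big_ord0 subrr subr0 normr0 !mul1r.
  by rewrite sqr_ge0.
have Mm : 0 < M ^+ m by rewrite exprn_gt0.
exists (M * C + C + M ^+ m); first by rewrite !addr_gt0 ?mulr_gt0.
move=> a b delta d0 aM bM ab.
have [H1 H2] := IH (a \o lift ord0) (b \o lift ord0) delta d0
  (fun k => aM _) (fun k => bM _) (fun k => ab _).
rewrite /= in H1 H2.
rewrite !big_ord_recl /= prod_lift0.
have -> : \sum_(i < m) (b (lift ord0 i) - a (lift ord0 i)) *
      \prod_(j < m.+1 | j != lift ord0 i) a j =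
    a ord0 * \sum_(i < m) (b (lift ord0 i) - a (lift ord0 i)) *
      \prod_(j < m | j != i) a (lift ord0 j).
  by rewrite mulr_sumr; apply: eq_bigr => i _; rewrite prod_lift mulrCA.
set P' := \prod_(i < m) b (lift ord0 i) in H1 H2 *.
set P := \prod_(i < m) a (lift ord0 i) in H1 H2 *.
set L := \sum_(i < m) _ in H2 *.
have P'M : `|P'| <= M ^+ m.
  rewrite /P' normr_prod -[m in leRHS]card_ord -prodr_const.
  by apply: ler_prod => i _; rewrite normr_ge0 bM.
split.
  have -> : b ord0 * P' - a ord0 * P = a ord0 * (P' - P) + (b ord0 - a ord0) * P' by ring.
  apply: le_trans (ler_normD _ _) _; rewrite !normrM.
  have h1 := ler_pM (normr_ge0 _) (normr_ge0 _) (aM ord0) H1.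
  have h2 := ler_pM (normr_ge0 _) (normr_ge0 _) (ab ord0) P'M.
  apply: le_trans (lerD h1 h2) _.
  have := mulr_ge0 (ltW C0) d0; lra.
have -> : b ord0 * P' - a ord0 * P - ((b ord0 - a ord0) * P + a ord0 * L) =
  a ord0 * (P' - P - L) + (b ord0 - a ord0) * (P' - P) by ring.
apply: le_trans (ler_normD _ _) _; rewrite !normrM.
have h1 := ler_pM (normr_ge0 _) (normr_ge0 _) (aM ord0) H2.
have h2 := ler_pM (normr_ge0 _) (normr_ge0 _) (ab ord0) H1.
apply: le_trans (lerD h1 h2) _.
have := mulr_ge0 (ltW Mm) (sqr_ge0 delta); lra.
Qed.

(** The transposition of [ord0] and [k] moves the distinguished index to the front, and symmetry
    keeps [A i] fixed. Hence all [m.+1] parts of the derivative coincide. *)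
Lemma tform_derivative_coord m (A : tensor R m.+1 n) x v (k : 'I_m.+1) :
  symmetric_tensor A ->
  \sum_(i : m.+1.-tuple 'I_n)
    A i * (v 0 (tnth i k) * \prod_(j < m.+1 | j != k) x 0 (tnth i j)) =
  dotv (tvec A x) v.
Proof.
move=> symA; rewrite dotv_tvec.
pose f (i : m.+1.-tuple 'I_n) := [tuple tnth i (tperm ord0 k j) | j < m.+1].
have ff : involutive f.
  by move=> i; apply: eq_from_tnth => j; rewrite !tnth_mktuple tpermK.
rewrite (reindex_inj (can_inj ff)) /=; apply: eq_bigr => i _.
rewrite symA tnth_mktuple tpermR; congr (_ * (_ * _)).
rewrite -(prod_lift0 (fun j => x 0 (tnth i j))) (reindex_inj (@perm_inj _ (tperm ord0 k))) /=.
apply: eq_big => j; last by rewrite tnth_mktuple tpermK.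
by rewrite -(inj_eq (@perm_inj _ (tperm ord0 k))) tpermK tpermR.
Qed.

Lemma tform_taylor m (A : tensor R m.+1 n) (M : R) : symmetric_tensor A -> 0 < M ->
  exists2 C : R, 0 < C & forall x x' (delta : R), 0 <= delta ->
   (forall i, `|x 0 i| <= M) -> (forall i, `|x' 0 i| <= M) ->
   (forall i, `|x' 0 i - x 0 i| <= delta) ->
   `|tform A x' - tform A x - m.+1%:R * dotv (tvec A x) (x' - x)| <= C * delta ^+ 2.
Proof.
move=> symA M0; have [C C0 H] := @prod_taylor m.+1 M M0.
exists (\sum_(i : m.+1.-tuple 'I_n) `|A i| * C + 1).
  by rewrite ltr_wpDl // sumr_ge0 // => i _; rewrite mulr_ge0 // ltW.
move=> x x' delta d0 xM x'M xx'.
have -> : m.+1%:R * dotv (tvec A x) (x' - x) = \sum_(i : m.+1.-tuple 'I_n)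
   A i * \sum_(k < m.+1) ((x' 0 (tnth i k) - x 0 (tnth i k)) *
      \prod_(j < m.+1 | j != k) x 0 (tnth i j)).
  under [RHS]eq_bigr do rewrite mulr_sumr.
  rewrite exchange_big /= mulr_natl -[m.+1 in LHS]card_ord -sumr_const.
  apply: eq_bigr => k _; rewrite -(tform_derivative_coord _ _ k symA).
  by apply: eq_bigr => i _; rewrite !mxE.
rewrite /tform -!sumrB mulrDl mul1r.
apply: le_trans (ler_norm_sum _ _ _) _.
apply: (@le_trans _ _ (\sum_(i : m.+1.-tuple 'I_n) `|A i| * C * delta ^+ 2)).
  apply: ler_sum => i _; rewrite -!mulrBr normrM -mulrA ler_wpM2l //.
  by have [_] := H (fun k => x 0 (tnth i k)) (fun k => x' 0 (tnth i k)) delta d0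
    (fun k => xM _) (fun k => x'M _) (fun k => xx' _).
by rewrite mulr_suml lerDl sqr_ge0.
Qed.

End TensorForms.

(** * The sphere [tform B x = 1] *)

Section Sphere.
Variables (R : realType) (m m' n : nat) (A : tensor R m.+1 n) (B : tensor R m'.+1 n).
Hypotheses (symA : symmetric_tensor A) (symB : symmetric_tensor B).
Hypothesis (posB : posdef_tensor B).
Implicit Types (x h z : 'rV[R]_n).

Lemma tform0 k (T : tensor R k.+1 n) : tform T 0 = 0.
Proof. by rewrite -(scale0r 0) tform_scale expr0n mul0r. Qed.

(** By homogeneity [tform B x] is at least the minimum of [tform B] over unit vectors times [|x|] to
    the power [m'.+1], and this minimum is positive. *)
Lemma sphere_bounded : exists2 M : R, 0 < M &
  forall x i, tform B x = 1 -> `|x 0 i| <= M.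
Proof.
(* The minimisation needs a unit vector to exist; if every vector is zero the bound is trivial. *)
have [[x0 x00]|H0] := pselect (exists x : 'rV[R]_n, x != 0); last first.
  exists 1 => // x i Bx; have [x0|x0] := eqVneq x 0; last by case: H0; exists x.
  by rewrite x0 mxE normr0.
pose U := [set u : 'rV[R]_n | `|u| = 1].
have Ucl : closed U by apply: closed_preimage_eq => x; exact: norm_continuous.
have Uco : compact U.
  by apply: (@compact_box _ _ _ 1) => // u i Uu; apply: le_trans (coord_le_norm u i) _; rewrite Uu.
have unit x : x != 0 -> U (`|x|^-1 *: x).
  move=> x_neq0; rewrite /U /= normrZ normfV normr_id mulVf //.
  by rewrite normr_eq0.
have Bc : {within U, continuous (tform B)}.
  by apply: continuous_subspaceT; exact/row_polynomial_continuous/tform_polynomial.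
have [u] := EVT_min_rV (ex_intro _ _ (unit _ x00)) Uco Bc.
rewrite inE => Uu umin.
have mu0 : 0 < tform B u.
  apply: posB; apply/eqP => u0; move: Uu; rewrite /U /= u0 normr0 => /eqP.
  by rewrite eq_sym oner_eq0.
exists (1 + (tform B u)^-1); first by rewrite addr_gt0 ?invr_gt0.
move=> x i Bx; apply: le_trans (coord_le_norm x i) _.
have [x1|x1] := leP `|x| 1; first by apply: le_trans x1 _; rewrite lerDl invr_ge0 ltW.
have xn0 : x != 0 by rewrite -normr_gt0; lra.
have := umin _ (mem_set (unit x xn0)); rewrite tform_scale Bx mulr1 => H.
have xk : `|x| <= `|x| ^+ m'.+1.
  by rewrite exprS ler_peMr // exprn_ege1 // ltW.
have X0 : 0 < `|x| ^+ m'.+1 by rewrite exprn_gt0 //; lra.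
rewrite exprVn in H.
have : `|x| ^+ m'.+1 <= (tform B u)^-1.
  by rewrite -[leLHS]invrK lef_pV2 // posrE invr_gt0.
lra.
Qed.

Lemma residual_polynomial i : row_polynomial (fun x => residual A B x 0 i).
Proof.
move=> K; rewrite /residual.
rewrite (_ : (fun e => _) = (fun e => tvec A (env_row n e K) 0 i +
   - (tform A (env_row n e K) * tvec B (env_row n e K) 0 i))).
  apply: term_fun_add; first exact: tvec_polynomial.
  apply: term_fun_opp; apply: term_fun_mul; last exact: tvec_polynomial.
  exact: tform_polynomial.
by apply/funext => e; rewrite !mxE.
Qed.

Lemma dotv_residual_self x : tform B x = 1 -> dotv (residual A B x) x = 0.
Proof.
by move=> Bx; rewrite /residual dotvDl dotvNl dotvZl !euler_tform Bx mulr1 subrr.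
Qed.

Lemma residual_bounded_lipschitz (M : R) : exists2 C : R, 0 < C &
  (forall x, (forall i, `|x 0 i| <= M) -> `|residual A B x| <= C) /\
  (forall x x' (delta : R), (forall i, `|x 0 i| <= M) -> (forall i, `|x' 0 i| <= M) ->
     0 <= delta -> (forall i, `|x' 0 i - x 0 i| <= delta) ->
     `|residual A B x' - residual A B x| <= C * delta).
Proof.
have H (i : 'I_n) : exists C : R, 0 < C /\
  ((forall x, (forall i, `|x 0 i| <= M) -> `|residual A B x 0 i| <= C) /\
  (forall x x' (delta : R), (forall i, `|x 0 i| <= M) -> (forall i, `|x' 0 i| <= M) ->
     0 <= delta -> (forall i, `|x' 0 i - x 0 i| <= delta) ->
     `|residual A B x' 0 i - residual A B x 0 i| <= C * delta)).
  by have [_ /(_ M) [C C0 HC]] := row_polynomial_regular (residual_polynomial i); exists C.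
have [Cf {}H] := choice H.
have C0 i : 0 <= Cf i by rewrite ltW //; have [] := H i.
have Cle i : Cf i <= \sum_i Cf i + 1.
  by rewrite (bigD1 i) //= -addrA lerDl addr_ge0 // sumr_ge0.
have S0 : 0 < \sum_i Cf i + 1 by rewrite ltr_wpDl // sumr_ge0.
exists (\sum_i Cf i + 1) => //; split=> [x xM|x x' delta xM x'M d0 xx'].
  apply: norm_le_coord; first exact: ltW.
  by move=> i; have [_ [b _]] := H i; apply: le_trans (b x xM) _.
apply: norm_le_coord; first by rewrite mulr_ge0 // ltW.
move=> i; have [_ [_ l]] := H i; rewrite !mxE.
have := l x x' delta xM x'M d0 xx'; rewrite !mxE => /le_trans -> //.
by rewrite ler_wpM2r.
Qed.

(* On the sphere the residual is, up to the factor [m.+1], the gradient of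
   [tform A]: the normal component [dotv (tvec B x) (x' - x)] is quadratic. *)
Lemma sphere_expansion : exists2 C : R, 0 < C & forall x x' (delta : R), 0 <= delta ->
  tform B x = 1 -> tform B x' = 1 -> (forall i, `|x' 0 i - x 0 i| <= delta) ->
  `|tform A x' - tform A x - m.+1%:R * dotv (residual A B x) (x' - x)| <= C * delta ^+ 2.
Proof.
have [M M0 bM] := sphere_bounded.
have [CA CA0 HA] := tform_taylor symA M0.
have [CB CB0 HB] := tform_taylor symB M0.
have [_ /(_ M) [Cf Cf0 [bf _]]] := row_polynomial_regular (tform_polynomial A).
exists (CA + m.+1%:R * Cf * CB); first by rewrite addr_gt0 // !mulr_gt0.
move=> x x' delta d0 Bx Bx' xx'.
have xM i : `|x 0 i| <= M by apply: bM.
have x'M i : `|x' 0 i| <= M by apply: bM.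
have hA := HA x x' delta d0 xM x'M xx'.
have := HB x x' delta d0 xM x'M xx'.
rewrite Bx Bx' subrr sub0r normrN normrM ger0_norm // => hB.
have hB' : `|dotv (tvec B x) (x' - x)| <= CB * delta ^+ 2.
  by apply: le_trans hB; rewrite ler_peMl // ler1n.
rewrite /residual dotvDl dotvNl dotvZl.
set a := dotv (tvec A x) _ in hA *; set b := dotv (tvec B x) _ in hB' *.
have -> : tform A x' - tform A x - m.+1%:R * (a - tform A x * b) =
  (tform A x' - tform A x - m.+1%:R * a) + m.+1%:R * (tform A x * b) by ring.
apply: le_trans (ler_normD _ _) _; rewrite mulrDl lerD //.
rewrite 2!normrM ger0_norm // -!mulrA ler_wpM2l //.
by rewrite ler_pM // bf.
Qed.

Lemma Bnorm_gt0 z : 0 < tform B z -> 0 < Bnorm B z.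
Proof. exact: powR_gt0. Qed.

Lemma Bnorm_pow z : 0 < tform B z -> Bnorm B z ^+ m'.+1 = tform B z.
Proof.
move=> Bz; rewrite -powR_mulrn ?powR_ge0 // /Bnorm -powRrM mulVf ?pnatr_eq0 //.
by rewrite powRr1 // ltW.
Qed.

Lemma tform_Bnormalize z : 0 < tform B z -> tform B (Bnormalize B z) = 1.
Proof.
move=> Bz; rewrite /Bnormalize tform_scale exprVn Bnorm_pow // mulVf //.
by rewrite gt_eqF.
Qed.

(** The cofactor [1 + q + ... + q ^+ k] of [q - 1] is at least 1. Closeness of [Bnorm] to 1 is thus
    inherited from [tform B], without estimates on roots. *)
Lemma dist1_le_exp (q : R) k : 0 < q -> `|q - 1| <= `|q ^+ k.+1 - 1|.
Proof.
move=> q0; rewrite subrX1 normrM ler_peMr //.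
rewrite big_ord_recl expr0 ger0_norm; last first.
  by rewrite addr_ge0 // sumr_ge0 // => i _; rewrite exprn_ge0 // ltW.
by rewrite lerDl sumr_ge0 // => i _; rewrite exprn_ge0 // ltW.
Qed.

Lemma Bnormalize_near : exists2 r : R, 0 < r & exists2 C : R, 0 < C &
  forall x h (delta : R), tform B x = 1 -> 0 <= delta <= r ->
  (forall i, `|h 0 i| <= delta) ->
  [/\ 0 < tform B (x + h), `|(Bnorm B (x + h))^-1 - 1| <= C * delta &
      forall i, `|Bnormalize B (x + h) 0 i - x 0 i| <= C * delta].
Proof.
have [M M0 bM] := sphere_bounded.
have [_ /(_ (M + 1)) [C1 C10 [_ L]]] := row_polynomial_regular (tform_polynomial B).
(* [r <= 1] keeps [x + h] in the box of radius [M + 1], and [C1 * r <= 1 / 2] keeps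
   [tform B (x + h)] and its root at least [1 / 2]. *)
pose r := (2 * C1 + 1)^-1.
have r0 : 0 < r by rewrite invr_gt0; lra.
have rE : r * (2 * C1 + 1) = 1 by rewrite mulVf // gt_eqF //; lra.
exists r => //; exists (2 * C1 * M + 2 + 2 * C1); first by have := mulr_gt0 C10 M0; lra.
move=> x h delta Bx /andP[d0 dr] hd.
have rle1 : r <= 1 by nra.
have C1d : C1 * delta <= 1 / 2.
  have : C1 * delta <= C1 * r by rewrite ler_pM2l.
  by nra.
have xM i : `|x 0 i| <= M by apply: bM.
have : `|tform B (x + h) - tform B x| <= C1 * delta.
  apply: L => // i.
  - by apply: le_trans (xM i) _; rewrite lerDl.
  - by rewrite mxE; apply: le_trans (ler_normD _ _) _; rewrite lerD // (le_trans (hd i)) //; lra.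
  - by rewrite mxE [x 0 i + _]addrC addrK.
rewrite Bx => pB.
have p0 : 0 < tform B (x + h) by move: pB; rewrite ler_norml; lra.
have q0 := Bnorm_gt0 p0.
have qB : `|Bnorm B (x + h) - 1| <= C1 * delta.
  by apply: le_trans (dist1_le_exp m' q0) _; rewrite Bnorm_pow.
set q := Bnorm B (x + h) in q0 qB *.
have qge : 1 / 2 <= q by move: qB; rewrite ler_norml; lra.
have c2 : q^-1 <= 2.
  by rewrite -[2]invrK lef_pV2 ?posrE ?invr_gt0 //; lra.
have c0 : 0 < q^-1 by rewrite invr_gt0.
have cB : `|q^-1 - 1| <= 2 * C1 * delta.
  have -> : q^-1 - 1 = - ((q - 1) * q^-1) by field; rewrite gt_eqF.
  rewrite normrN normrM (gtr0_norm c0).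
  have := ler_pM (normr_ge0 _) (ltW c0) qB c2; lra.
split=> //.
  apply: le_trans cB _; have := mulr_ge0 (mulr_ge0 (ltW C10) (ltW M0)) d0; lra.
move=> i; rewrite /Bnormalize -/q !mxE.
have -> : q^-1 * (x 0 i + h 0 i) - x 0 i = (q^-1 - 1) * x 0 i + q^-1 * h 0 i by ring.
apply: le_trans (ler_normD _ _) _; rewrite !normrM (gtr0_norm c0).
have h1 := ler_pM (normr_ge0 _) (normr_ge0 _) cB (xM i).
have h2 := ler_pM (ltW c0) (normr_ge0 _) c2 (hd i).
have := mulr_ge0 (ltW C10) d0; lra.
Qed.

(** The residual is orthogonal to [x], so normalisation multiplies the linear term by a factor
    within [O(delta)] of 1, a second order effect. The factor [m.+1] of [sphere_expansion] cancels
    against the one in [objective]. *)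
Lemma objective_expansion : exists2 r : R, 0 < r & exists2 C : R, 0 < C &
  forall x h (delta : R), tform B x = 1 -> 0 <= delta <= r ->
  (forall i, `|h 0 i| <= delta) ->
  objective A (Bnormalize B (x + h)) <=
    objective A x + dotv (residual A B x) h + C * delta ^+ 2.
Proof.
have [M M0 bM] := sphere_bounded.
have [r r0 [C1 C10 near1]] := Bnormalize_near.
have [C2 C20 exp2] := sphere_expansion.
have [C3 C30 [bF _]] := residual_bounded_lipschitz M.
exists r => //; exists (C1 * (n%:R * C3) + C2 * C1 ^+ 2).
  by rewrite ltr_wpDl ?mulr_gt0 ?exprn_gt0 // !mulr_ge0 // ltW.
move=> x h delta Bx dr hd; have [p0 cB xB] := near1 x h delta Bx dr hd.
have /andP[d0 _] := dr.
have d10 : 0 <= C1 * delta by rewrite mulr_ge0 // ltW.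
have := exp2 x (Bnormalize B (x + h)) _ d10 Bx (tform_Bnormalize p0) xB.
set c := (Bnorm B (x + h))^-1 in cB *; set F := residual A B x.
have Fx0 : dotv F x = 0 by apply: dotv_residual_self.
have -> : dotv F (Bnormalize B (x + h) - x) = c * dotv F h.
  by rewrite /Bnormalize -/c dotvDr dotvNr dotvZr dotvDr Fx0 add0r subr0.
have Fh : `|dotv F h| <= n%:R * (C3 * delta).
  by apply: dotv_le => // i; apply: le_trans (coord_le_norm _ _) _; apply: bF => j; apply: bM.
have cF : c * dotv F h <= dotv F h + C1 * (n%:R * C3) * delta ^+ 2.
  have -> : c * dotv F h = dotv F h + (c - 1) * dotv F h by ring.
  rewrite lerD2l; apply: le_trans (ler_norm _) _; rewrite normrM.
  have := ler_pM (normr_ge0 _) (normr_ge0 _) cB Fh; lra.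
rewrite ler_norml => /andP[_ H].
have m1 : 1 <= m.+1%:R :> R by rewrite ler1n.
have m0 : 0 < m.+1%:R :> R by lra.
rewrite /objective -(ler_pM2l m0) mulVKf ?gt_eqF //.
rewrite !mulrDr mulVKf ?gt_eqF //.
have cF' : m.+1%:R * (c * dotv F h) <=
  m.+1%:R * dotv F h + m.+1%:R * (C1 * (n%:R * C3) * delta ^+ 2).
  by rewrite -mulrDr ler_pM2l.
have H2 : C2 * (C1 * delta) ^+ 2 <= m.+1%:R * (C2 * C1 ^+ 2 * delta ^+ 2).
  have -> : C2 * (C1 * delta) ^+ 2 = C2 * C1 ^+ 2 * delta ^+ 2 by ring.
  rewrite ler_peMl //.
  by rewrite !mulr_ge0 ?exprn_ge0 // ltW.
rewrite mulrDl mulrDr; lra.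
Qed.

(** The abstract inequality is applied to [tform B - 1], [tform A - ls] and the coordinates of the
    residual; [sphere_expansion] supplies the Lipschitz hypothesis. *)
Lemma residual_lojasiewicz (ls : R) : exists2 eps : R, 0 < eps & exists2 t0 : R, 0 < t0 &
  forall x, tform B x = 1 -> 0 < tform A x - ls < t0 ->
    eps * (tform A x - ls) <= `|residual A B x|.
Proof.
have [M M0 bM] := sphere_bounded.
have [C C0 expS] := sphere_expansion.
have ph : row_polynomial (fun x => tform B x + - 1).
  move=> K; apply: term_fun_add; [exact: tform_polynomial|exact: (term_fun_cst (-1))].
have pg : row_polynomial (fun x => tform A x + - ls).
  move=> K; apply: term_fun_add; [exact: tform_polynomial|exact: (term_fun_cst (- ls))].
have hE x : tform B x + - 1 = 0 -> tform B x = 1 by move=> /subr0_eq.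
have bnd x i : tform B x + - 1 = 0 -> `|x 0 i| <= M by move=> /hE; apply: bM.
have C'0 : 0 < m.+1%:R * n%:R + C by rewrite ltr_wpDl // mulr_ge0.
have lip x x' (eta delta : R) : tform B x + - 1 = 0 -> tform B x' + - 1 = 0 ->
    0 <= eta -> 0 <= delta -> (forall i, `|residual A B x 0 i| <= eta) ->
    (forall i, `|x' 0 i - x 0 i| <= delta) ->
    `|tform A x' + - ls - (tform A x + - ls)| <=
      (m.+1%:R * n%:R + C) * (eta * delta + delta ^+ 2).
  move=> /hE Bx /hE Bx' eta0 d0 Fx xx'.
  have E := expS x x' delta d0 Bx Bx' xx'.
  have G : `|dotv (residual A B x) (x' - x)| <= n%:R * (eta * delta).
    by apply: dotv_le => // i; rewrite !mxE; have := xx' i; rewrite ?mxE.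
  have -> : tform A x' + - ls - (tform A x + - ls) =
    (tform A x' - tform A x - m.+1%:R * dotv (residual A B x) (x' - x)) +
     m.+1%:R * dotv (residual A B x) (x' - x) by ring.
  apply: le_trans (ler_normD _ _) _; rewrite normrM ger0_norm //.
  have G' := ler_wpM2l (ler0n R m.+1) G.
  apply: le_trans (lerD E G') _.
  have := mulr_ge0 (ltW C0) (mulr_ge0 eta0 d0).
  have := mulr_ge0 (mulr_ge0 (ler0n R m.+1) (ler0n R n)) (sqr_ge0 delta); lra.
have [eps eps0 [t0 t00 H]] := lojasiewicz ph pg residual_polynomial
  (row_polynomial_continuous ph) (row_polynomial_continuous pg)
  (fun i => row_polynomial_continuous (residual_polynomial i)) M0 C'0 bnd lip.
exists eps => //; exists t0 => // x Bx tx.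
have [|i Hi] := H x _ tx; first by rewrite Bx subrr.
exact: le_trans (ltW Hi) (coord_le_norm _ _).
Qed.

End Sphere.

(** * Growth of the directions against decay of the gap *)

Section Dynamics.
(** For a tail of a run, [Dl], [D], [s], [F] and [al] stand for the gap to the limit value, the norm
    of the direction, the step length, the norm of the residual and the step size. *)
Variables (R : realType) (c C delta : R) (Dl D s F al : nat -> R).
Hypotheses (c0 : 0 < c) (C0 : 0 < C) (delta0 : 0 < delta).
Hypotheses (Dl0 : forall k, 0 < Dl k).
Hypothesis (Dl_small : forall e, 0 < e -> exists K, forall k, (K <= k)%N -> Dl k < e).
Hypotheses (s0 : forall k, 0 <= s k) (F0 : forall k, 0 < F k) (D0 : forall k, 0 <= D k).
Hypothesis (FC : forall k, F k <= C).
Hypothesis (descent_s : forall k, c * s k ^+ 2 <= Dl k - Dl k.+1).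
Hypothesis (descent_F : forall k, c * al k * F k ^+ 2 <= Dl k - Dl k.+1).
Hypothesis (recD : forall k,
  D k.+1 * F k ^+ 2 <= F k.+1 * F k ^+ 2 + C * F k.+1 * s k * D k).
Hypotheses (F_up : forall k, F k.+1 <= F k + C * s k).
Hypothesis (F_down : forall k, F k <= F k.+1 + C * s k).
Hypothesis (step_lb : forall k, delta <= al k \/ c * F k ^+ 2 <= al k * D k ^+ 2).
Hypothesis (loj : forall k, c * Dl k <= F k).

Let Dl_dec k i : Dl (k + i)%N <= Dl k.
Proof.
elim: i => [|i IH]; first by rewrite addn0.
rewrite addnS; have := descent_s (k + i); have : 0 <= c * s (k + i) ^+ 2.
  by rewrite mulr_ge0 ?sqr_ge0 // ltW.
lra.
Qed.

(** The floor [2 * C] absorbs the additive term of the recursion, so that the growth becomes purely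
    multiplicative. *)
Let E k := Num.max (D k) (2 * C).
Let Kc := 3 / 2 * C ^+ 2 / c ^+ 3.

Let Kc0 : 0 < Kc.
Proof. by rewrite divr_gt0 ?exprn_gt0 // mulr_gt0 ?exprn_gt0. Qed.

Let E0 k : 0 < E k.
Proof. by rewrite lt_max [0 < 2 * C]mulr_gt0 ?orbT. Qed.

(* The factor by which [D] can grow in one step is controlled by [(s / F)^2],
   which telescopes to a multiple of [1 / Dl] thanks to [descent_s] and [loj]. *)
Let growth_step k : E k.+1 <= E k * expR (Kc * ((Dl k.+1)^-1 - (Dl k)^-1)).
Proof.
have [r r0 sE] : exists2 r, 0 <= r & s k = r * F k.
  by exists (s k / F k); [rewrite divr_ge0 // ltW|rewrite divfK // gt_eqF].
have HD : D k <= E k by rewrite le_max lexx.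
have HC : 2 * C <= E k by rewrite le_max lexx orbT.
have r2 : c ^+ 3 * r ^+ 2 <= (Dl k.+1)^-1 - (Dl k)^-1.
  have a0 := Dl0 k; have b0 := Dl0 k.+1.
  have -> : (Dl k.+1)^-1 - (Dl k)^-1 = (Dl k - Dl k.+1) / (Dl k * Dl k.+1).
    by field; rewrite !gt_eqF.
  rewrite ler_pdivlMr ?mulr_gt0 //.
  apply: le_trans (descent_s k); rewrite sE exprMn.
  have ba : Dl k.+1 <= Dl k by have := Dl_dec k 1; rewrite addn1.
  have H : c ^+ 2 * (Dl k * Dl k.+1) <= F k ^+ 2.
    apply: (@le_trans _ _ ((c * Dl k) ^+ 2)).
      by rewrite exprMn ler_wpM2l ?sqr_ge0 // expr2 ler_pM2l.
    by rewrite ler_sqr ?nnegrE ?loj // ?ltW // mulr_gt0.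
  have -> : c ^+ 3 * r ^+ 2 * (Dl k * Dl k.+1) = c * (r ^+ 2 * (c ^+ 2 * (Dl k * Dl k.+1))) by ring.
  by rewrite ler_pM2l // ler_wpM2l ?sqr_ge0.
(* Dividing the recursion by [F k ^+ 2] and inserting [F k.+1 <= (1 + C * r) * F k] leaves only the
   ratio [r]. *)
have D1 : D k.+1 <= C + (C * r + C ^+ 2 * r ^+ 2) * D k.
  have F2 : 0 < F k ^+ 2 by rewrite exprn_gt0.
  rewrite -(ler_pM2r F2); apply: le_trans (recD k) _.
  rewrite mulrDl lerD //; first by rewrite ler_pM2r.
  have -> : (C * r + C ^+ 2 * r ^+ 2) * D k * F k ^+ 2 =
     (C * r * F k * D k) * (F k + C * (r * F k)) by ring.
  have -> : C * F k.+1 * s k * D k = (C * r * F k * D k) * F k.+1 by rewrite sE; ring.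
  rewrite ler_wpM2l //; last by rewrite -sE.
  by rewrite !mulr_ge0 // ltW.
(* Half of [E k] pays for [C], the other half for the constant part of
   [C * r <= 1 / 2 + (C * r) ^+ 2 / 2]. No term linear in [r] survives; only [r ^+ 2] can be
   telescoped. *)
have E1 : E k.+1 <= E k * (1 + 3 / 2 * C ^+ 2 * r ^+ 2).
  have P : 0 <= C ^+ 2 * r ^+ 2 by rewrite mulr_ge0 ?sqr_ge0.
  rewrite ge_max; apply/andP; split; last first.
    have := E0 k; nra.
  have H : (C * r + C ^+ 2 * r ^+ 2) * D k <= (C * r + C ^+ 2 * r ^+ 2) * E k.
    by rewrite ler_wpM2l // addr_ge0 // mulr_ge0 // ltW.
  have H2 : C * r <= 1 / 2 + C ^+ 2 * r ^+ 2 / 2.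
    have := sqr_ge0 (C * r - 1); lra.
  have := ler_wpM2r (ltW (E0 k)) H2; lra.
apply: le_trans E1 _; rewrite ler_pM2l //.
apply: le_trans (expR_ge1Dx _) _; rewrite ler_expR.
have -> : 3 / 2 * C ^+ 2 * r ^+ 2 = Kc * (c ^+ 3 * r ^+ 2).
  by rewrite /Kc; field; rewrite gt_eqF.
by rewrite ler_pM2l.
Qed.

Let growth k : E k <= E 0 * expR (Kc / Dl k).
Proof.
suff H : E k <= E 0 * expR (Kc * ((Dl k)^-1 - (Dl 0)^-1)).
  apply: le_trans H _; rewrite ler_pM2l // ler_expR ler_pM2l // gerBl.
  by rewrite invr_ge0 ltW.
elim: k => [|k IH]; first by rewrite subrr mulr0 expR0 mulr1.
apply: le_trans (growth_step k) _.
have -> : Kc * ((Dl k.+1)^-1 - (Dl 0)^-1) = Kc * ((Dl k)^-1 - (Dl 0)^-1) +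
   Kc * ((Dl k.+1)^-1 - (Dl k)^-1) by ring.
by rewrite expRD mulrA ler_pM2r // expR_gt0.
Qed.

Lemma residual_vanishes e : 0 < e -> exists K, forall k, (K <= k)%N -> F k < e.
Proof.
move=> e'0; pose eps := e / 2; have eps0 : 0 < eps by rewrite divr_gt0.
(* [c' / Dl k] is the number of steps during which the residual provably stays above [eps]. *)
pose c' := c * eps ^+ 2 / C ^+ 2.
have c'0 : 0 < c' by rewrite divr_gt0 ?mulr_gt0 ?exprn_gt0.
(* [Q * c' = Kc + 1]: contraction over the window beats the growth bound [expR (Kc / Dl k)] and
   leaves a spare factor [expR (- (Dl k)^-1)]. *)
pose Q := (Kc + 1) / c'.
pose q := expR (- Q).
have q0 : 0 < q by rewrite expR_gt0.
(* Thresholds for the gap: [b1] rules out steps of size at least [delta], [b2] rules out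
   [D < 2 * C], [b3] makes [s] small enough for contraction by [q], and [b4] yields the final
   contradiction. *)
pose b1 := c * delta * eps ^+ 2.
pose b2 := c ^+ 2 * eps ^+ 4 / (4 * C ^+ 2).
pose b3 := c * (q * eps ^+ 2 / (2 * C ^+ 2)) ^+ 2.
pose b4 := 2 * C / (E 0 * expR Q).
have b1p : 0 < b1 by rewrite !mulr_gt0 ?exprn_gt0.
have b2p : 0 < b2 by rewrite divr_gt0 ?mulr_gt0 ?exprn_gt0.
have b3p : 0 < b3 by rewrite mulr_gt0 ?exprn_gt0 ?divr_gt0 ?mulr_gt0 ?exprn_gt0.
have b4p : 0 < b4 by rewrite divr_gt0 ?mulr_gt0 ?expR_gt0.
have bp : 0 < Num.min (Num.min b1 b2) (Num.min b3 b4).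
  by rewrite !lt_min b1p b2p b3p b4p.
have [K KP] := Dl_small bp.
exists K => k /KP; rewrite !lt_min -andbA => /and4P[d1 d2 d3 d4].
rewrite ltNge; apply/negP => Fk.
have dk := Dl0 k.
pose N := Num.truncn (c' / Dl k).
have /andP[N1 N2] : N%:R <= c' / Dl k < N.+1%:R.
  by apply: truncn_itv; rewrite divr_ge0 // ltW.
have win i : (i <= N)%N -> eps <= F (k + i)%N.
  (* Each [s] is at most [eta / 2 + s ^+ 2 / (2 * eta)], and the squares sum to at most [Dl k / c].
     This [eta] balances the two sums: each costs at most [eps / 2] of the initial [2 * eps]. *)
  move=> iN; pose eta := C / (c * eps) * Dl k.
  have eta0 : 0 < eta by rewrite mulr_gt0 // divr_gt0 // mulr_gt0.
  suff H : F k <= F (k + i)%N + C * (i%:R * eta / 2 + (Dl k - Dl (k + i)%N) / (2 * eta * c)).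
    have h1 : C * (i%:R * eta / 2) <= eps / 2.
      have : i%:R * Dl k <= c'.
        rewrite -ler_pdivlMr //; apply: le_trans N1; by rewrite ler_nat.
      have -> : C * (i%:R * eta / 2) = (C ^+ 2 / (2 * c * eps)) * (i%:R * Dl k).
        by rewrite /eta; field; rewrite !gt_eqF.
      have -> : eps / 2 = (C ^+ 2 / (2 * c * eps)) * c'.
        by rewrite /c'; field; rewrite !gt_eqF.
      by rewrite ler_pM2l // divr_gt0 ?exprn_gt0 ?mulr_gt0.
    have h2 : C * ((Dl k - Dl (k + i)%N) / (2 * eta * c)) <= eps / 2.
      have -> : eps / 2 = C * (Dl k / (2 * eta * c)).
        by rewrite /eta; field; rewrite !gt_eqF.
      rewrite ler_pM2l // ler_pM2r; first by rewrite gerBl ltW.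
      by rewrite invr_gt0 mulr_gt0 // mulr_gt0.
    rewrite mulrDr in H; have := le_trans H (lerD (lexx _) (lerD h1 h2)).
    move: Fk; rewrite {1}(splitr e) -/eps; lra.
  elim: i {iN} => [|i IH]; first by rewrite addn0 subrr !mul0r !addr0 mulr0 addr0.
  apply: le_trans IH _; apply: le_trans (lerD (F_down (k + i)) (lexx _)) _.
  rewrite -addnS -addrA lerD2l -mulrDr ler_pM2l // -[i.+1%:R]natr1.
  have am : s (k + i)%N <= eta / 2 + s (k + i)%N ^+ 2 / (2 * eta).
    have -> : eta / 2 + s (k + i)%N ^+ 2 / (2 * eta) =
      s (k + i)%N + (s (k + i)%N - eta) ^+ 2 / (2 * eta) by field; rewrite gt_eqF.
    by rewrite lerDl divr_ge0 ?sqr_ge0 // mulr_ge0 // ltW.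
  have ds : s (k + i)%N ^+ 2 / (2 * eta) <= (Dl (k + i)%N - Dl (k + i).+1) / (2 * eta * c).
    have -> : s (k + i)%N ^+ 2 / (2 * eta) = c * s (k + i)%N ^+ 2 / (2 * eta * c).
      by field; rewrite !gt_eqF.
    rewrite ler_pM2r ?descent_s //; by rewrite invr_gt0 mulr_gt0 // mulr_gt0.
  rewrite addnS.
  have -> : (i%:R + 1) * eta / 2 + (Dl k - Dl (k + i).+1) / (2 * eta * c) =
    (i%:R * eta / 2 + (Dl k - Dl (k + i)%N) / (2 * eta * c)) + (eta / 2 +
     (Dl (k + i)%N - Dl (k + i).+1) / (2 * eta * c)) by ring.
  lra.
(* A step of size at least [delta] would decrease the gap by [b1]. Otherwise [al * D ^+ 2] is
   bounded below, so a small [D] would make [al], and with it the decrease, too large. *)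
have big i : (i <= N)%N -> 2 * C <= D (k + i)%N.
  move=> iN; have Fi := win i iN; have Di := Dl_dec k i.
  have dF := descent_F (k + i); have D'0 := Dl0 (k + i).+1.
  have F2 : eps ^+ 2 <= F (k + i)%N ^+ 2 by rewrite ler_sqr ?nnegrE // ltW.
  have e2 : 0 < eps ^+ 2 by rewrite exprn_gt0.
  have [al1|al2] := step_lb (k + i).
    have : b1 <= c * al (k + i)%N * F (k + i)%N ^+ 2.
      apply: ler_pM => //; [by rewrite ltW // mulr_gt0|exact: ltW|by rewrite ler_pM2l].
    lra.
  rewrite leNgt; apply/negP => Dlt.
  have : c ^+ 2 * eps ^+ 4 <= Dl k * (4 * C ^+ 2).
    have H1 : c * (c * F (k + i)%N ^+ 2) * F (k + i)%N ^+ 2 <=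
              c * (al (k + i)%N * D (k + i)%N ^+ 2) * F (k + i)%N ^+ 2.
      by rewrite ler_wpM2r ?sqr_ge0 // ler_pM2l.
    have H2 : c * (al (k + i)%N * D (k + i)%N ^+ 2) * F (k + i)%N ^+ 2 <=
       Dl k * D (k + i)%N ^+ 2.
      rewrite (_ : _ * _ = c * al (k + i)%N * F (k + i)%N ^+ 2 * D (k + i)%N ^+ 2); last by ring.
      by rewrite ler_wpM2r ?sqr_ge0 //; lra.
    have H3 : Dl k * D (k + i)%N ^+ 2 <= Dl k * (4 * C ^+ 2).
      rewrite ler_pM2l // (_ : 4 * C ^+ 2 = (2 * C) ^+ 2); last by ring.
      by rewrite ler_sqr ?nnegrE // ltW // mulr_gt0.
    have H4 : c ^+ 2 * eps ^+ 4 <= c * (c * F (k + i)%N ^+ 2) * F (k + i)%N ^+ 2.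
      rewrite (_ : c ^+ 2 * eps ^+ 4 = c ^+ 2 * (eps ^+ 2 * eps ^+ 2)); last by ring.
      rewrite (_ : c * (c * _) * _ = c ^+ 2 * (F (k + i)%N ^+ 2 * F (k + i)%N ^+ 2)); last by ring.
      by rewrite ler_pM2l ?exprn_gt0 // ler_pM // ltW.
    lra.
  by apply/negP; rewrite -ltNge -ltr_pdivlMr // mulr_gt0 ?exprn_gt0.
(* Since the next [D] is at least [2 * C], half of the left side of the recursion absorbs the
   additive term. *)
have contract i : (i < N)%N -> D (k + i.+1)%N <= q * D (k + i)%N.
  move=> iN; have Fi := win i (ltnW iN); have D'b := big i.+1 iN.
  have F2 : 0 < F (k + i)%N ^+ 2 by rewrite exprn_gt0.
  have Fe : eps ^+ 2 <= F (k + i)%N ^+ 2 by rewrite ler_sqr ?nnegrE // ltW.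
  have rD := recD (k + i); have FC' := FC (k + i).+1; rewrite addnS in D'b *.
  have sb : s (k + i)%N <= q * eps ^+ 2 / (2 * C ^+ 2).
    rewrite -ler_sqr ?nnegrE //; last first.
      by rewrite ltW // divr_gt0 ?mulr_gt0 ?exprn_gt0.
    rewrite -(ler_pM2l c0); apply: le_trans (descent_s (k + i)) _.
    have := Dl_dec k i; have := Dl0 (k + i).+1; rewrite -/b3; lra.
  have H1 : F (k + i).+1 * F (k + i)%N ^+ 2 <= D (k + i).+1 / 2 * F (k + i)%N ^+ 2.
    by rewrite ler_pM2r //; lra.
  have H2 : C * F (k + i).+1 * s (k + i)%N * D (k + i)%N <=
      C * C * (q * eps ^+ 2 / (2 * C ^+ 2)) * D (k + i)%N.
    by rewrite ler_wpM2r // ler_pM // ?ler_pM2l // ltW // mulr_gt0.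
  have H3 : C * C * (q * eps ^+ 2 / (2 * C ^+ 2)) * D (k + i)%N <=
     q * D (k + i)%N / 2 * F (k + i)%N ^+ 2.
    rewrite (_ : C * C * _ * _ = q * D (k + i)%N / 2 * eps ^+ 2); last first.
      by field; rewrite gt_eqF.
    by rewrite ler_wpM2l // mulr_ge0 // mulr_ge0 // ltW.
  have H4 : D (k + i).+1 / 2 * F (k + i)%N ^+ 2 <= q * D (k + i)%N / 2 * F (k + i)%N ^+ 2 by lra.
  by move: H4; rewrite ler_pM2r //; lra.
have geo i : (i <= N)%N -> D (k + i)%N <= q ^+ i * D k.
  elim: i => [|i IH] iN; first by rewrite addn0 expr0 mul1r.
  apply: le_trans (contract i iN) _; rewrite exprS -mulrA ler_pM2l //.
  exact: IH (ltnW iN).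
have fin : 2 * C <= expR (- (Q * N%:R)) * (E 0 * expR (Kc / Dl k)).
  apply: le_trans (big N (leqnn _)) _; apply: le_trans (geo N (leqnn _)) _.
  rewrite -mulNr mulrC [_ * N%:R]mulrC expRM_natl mulrC ler_pM2l ?exprn_gt0 //.
  by apply: le_trans (growth k); rewrite le_max lexx.
(* By [c' / Dl k < N + 1] the combined exponent is at most [Q - (Dl k)^-1], and
   [expR (- (Dl k)^-1) <= Dl k]. *)
have : expR (- (Q * N%:R)) * (E 0 * expR (Kc / Dl k)) <= E 0 * expR Q * Dl k.
  rewrite mulrCA -mulrA ler_pM2l // -expRD.
  have -> : expR Q * Dl k = expR Q / (Dl k)^-1 by rewrite invrK.
  rewrite ler_pdivlMr ?invr_gt0 //.
  apply: (@le_trans _ _ (expR (- (Q * N%:R) + Kc / Dl k) * expR (Dl k)^-1)).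
    rewrite ler_pM2l ?expR_gt0 //; apply: le_trans (expR_ge1Dx _).
    by rewrite lerDr.
  rewrite -expRD ler_expR.
  have : Q * (c' / Dl k) <= Q * (N%:R + 1).
    by rewrite ler_pM2l ?natr1 ?ltW // divr_gt0 // addr_gt0.
  have -> : Q * (c' / Dl k) = Kc / Dl k + (Dl k)^-1.
    by rewrite /Q; field; rewrite !gt_eqF.
  lra.
have : E 0 * expR Q * Dl k < 2 * C.
  by rewrite mulrC -ltr_pdivlMr // mulr_gt0 ?expR_gt0.
lra.
Qed.

End Dynamics.

(** * Runs of the algorithm *)

Section Run.
Variables (R : realType) (m m' n : nat) (A : tensor R m.+1 n) (B : tensor R m'.+1 n).
Hypotheses (symA : symmetric_tensor A) (symB : symmetric_tensor B).
Hypothesis (posB : posdef_tensor B).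
Variables (rho sigma1 sigma2 delta : R).
Hypotheses (rho01 : 0 < rho < 1) (sigma1_01 : 0 < sigma1 < 1).
Hypotheses (sigma2_gt0 : 0 < sigma2) (delta_gt0 : 0 < delta).
Variables (u0 : 'rV[R]_n) (x d : nat -> 'rV[R]_n) (alpha lambda : nat -> R).
Hypothesis u0_neq0 : u0 != 0.
Hypothesis run : FCG_run A B rho sigma1 sigma2 delta u0 x d alpha lambda.

Let F k := residual A B (x k).
Let s k := alpha k * `|d k|.

Lemma alpha_gt0 k : 0 < alpha k.
Proof.
have [[[i ->] _] _] := FCG_alpha run k.
by rewrite mulr_gt0 // exprn_gt0 //; case/andP: rho01.
Qed.

Lemma dotv_residual_gt0 k : 0 < dotv (F k) (F k).
Proof.
apply: lt_le_trans (norm_sqr_le_dotv _); rewrite exprn_gt0 // normr_gt0.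
exact: FCG_continue run k.
Qed.

(** Paired with the new residual, the [beta] and [theta] terms cancel, whatever the line search
    did. *)
Lemma dotv_residual_direction k : dotv (F k) (d k) = - dotv (F k) (F k).
Proof.
case: k => [|k]; first by rewrite (FCG_d0 run) dotvNr.
have orth (u v w : 'rV[R]_n) : dotv u u != 0 ->
    dotv v (- v + (dotv v (v - u) / dotv u u) *: w - (dotv v w / dotv u u) *: (v - u)) =
    - dotv v v.
  by move=> uu; rewrite !dotvDr !dotvNr !dotvZr !dotvDr !dotvNr; field.
rewrite (FCG_dS run k) enorm_sqr; apply: orth.
by rewrite gt_eqF // dotv_residual_gt0.
Qed.

(** Paired with the residual, which is orthogonal to [x k], the unnormalised iterate gives
    [- alpha k * dotv (F k) (F k)], which is nonzero; so normalisation is legitimate. *)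
Lemma run_sphere k : tform B (x k) = 1 /\ x k + alpha k *: d k != 0.
Proof.
have step j : tform B (x j) = 1 -> x j + alpha j *: d j != 0.
  move=> Bx; apply/eqP => z0.
  have : dotv (F j) (x j + alpha j *: d j) = 0.
    by rewrite z0 -(scale0r 0) dotvZr mul0r.
  rewrite dotvDr dotvZr dotv_residual_self // dotv_residual_direction add0r.
  by have := mulr_gt0 (alpha_gt0 j) (dotv_residual_gt0 j); lra.
elim: k => [|k [Bx zx]].
  have Bx : tform B (x 0) = 1 by rewrite (FCG_x0 run) tform_Bnormalize // posB.
  by split=> //; apply: step.
have Bx' : tform B (x k.+1) = 1 by rewrite (FCG_xS run) tform_Bnormalize // posB.
by split=> //; apply: step.
Qed.

Lemma run_descent k :
  lambda k.+1 <= lambda k - sigma1 * alpha k * `|F k| ^+ 2 - sigma2 * s k ^+ 2.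
Proof.
have [[_ H] _] := FCG_alpha run k; move: H.
rewrite -(FCG_xS run) /objective -!(FCG_lambda run) -/(F k) dotv_residual_direction enorm_sqr.
have m0 : 0 < m.+1%:R :> R by [].
have m1 : 1 <= m.+1%:R :> R by rewrite ler1n.
rewrite -(ler_pM2l m0) mulVKf ?gt_eqF // !(mulrDr, mulrN) mulVKf ?gt_eqF //.
have a0 := alpha_gt0 k; have /andP[s10 _] := sigma1_01.
have h1 : sigma1 * alpha k * `|F k| ^+ 2 <= m.+1%:R * (sigma1 * alpha k * dotv (F k) (F k)).
  apply: (@le_trans _ _ (sigma1 * alpha k * dotv (F k) (F k))).
    by rewrite ler_pM2l ?mulr_gt0 // norm_sqr_le_dotv.
  rewrite ler_peMl // mulr_ge0 ?(ltW (dotv_residual_gt0 k)) //.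
  by rewrite ltW // mulr_gt0.
have h2 : sigma2 * s k ^+ 2 <= m.+1%:R * (sigma2 * alpha k ^+ 2 * dotv (d k) (d k)).
  apply: (@le_trans _ _ (sigma2 * alpha k ^+ 2 * dotv (d k) (d k))).
    rewrite /s exprMn mulrA ler_pM2l ?norm_sqr_le_dotv //.
    by rewrite mulr_gt0 // exprn_gt0.
  rewrite ler_peMl // mulr_ge0 //; first by rewrite mulr_ge0 ?sqr_ge0 // ltW.
  by apply: le_trans (norm_sqr_le_dotv _); rewrite sqr_ge0.
lra.
Qed.

Lemma residual_norm_gt0 k : 0 < `|F k|.
Proof. by rewrite normr_gt0 (FCG_continue run k). Qed.

Lemma run_decreasing k : lambda k.+1 < lambda k.
Proof.
apply: le_lt_trans (run_descent k) _.
have /andP[s10 _] := sigma1_01.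
have := mulr_gt0 (mulr_gt0 s10 (alpha_gt0 k)) (exprn_gt0 2 (residual_norm_gt0 k)).
have := mulr_ge0 (ltW sigma2_gt0) (sqr_ge0 (s k)); lra.
Qed.

Lemma run_nonincreasing : nonincreasing_seq lambda.
Proof. by apply/nonincreasing_seqP => k; rewrite ltW // run_decreasing. Qed.

Lemma run_cvg : cvgn lambda.
Proof.
have [M M0 bM] := sphere_bounded posB.
have [_ /(_ M) [C C0 [bA _]]] := row_polynomial_regular (tform_polynomial A).
apply: nonincreasing_is_cvgn run_nonincreasing _; exists (- C) => _ [k _ <-].
have := bA (x k) (fun i => bM _ _ (run_sphere k).1).
by rewrite ler_norml (FCG_lambda run) => /andP[].
Qed.

Let ls := limn lambda.

Lemma run_gap_gt0 k : 0 < lambda k - ls.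
Proof.
rewrite subr_gt0; apply: le_lt_trans _ (run_decreasing k).
exact: nonincreasing_cvgn_ge run_nonincreasing run_cvg k.+1.
Qed.

Lemma run_gap_small e : 0 < e -> exists K, forall k, (K <= k)%N -> lambda k - ls < e.
Proof.
move=> e0; have /cvgrPdist_lt /(_ e e0) [K _ HK] := run_cvg.
exists K => k kK; have := HK k kK; rewrite -/ls ltr_norml; lra.
Qed.

Lemma step_size_small e : 0 < e -> exists K, forall k, (K <= k)%N -> s k < e.
Proof.
move=> e0; have e2 : 0 < sigma2 * e ^+ 2 by rewrite mulr_gt0 // exprn_gt0.
have [K HK] := run_gap_small e2; exists K => k /HK H.
have a0 := alpha_gt0 k.
have sk : 0 <= s k by rewrite mulr_ge0 // ltW.
suff : s k ^+ 2 < e ^+ 2 by rewrite ltr_sqr ?nnegrE // ltW.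
rewrite -(ltr_pM2l sigma2_gt0); apply: le_lt_trans _ H.
have := run_descent k; have := run_gap_gt0 k.+1.
have /andP[s10 _] := sigma1_01.
have := mulr_gt0 (mulr_gt0 s10 a0) (exprn_gt0 2 (residual_norm_gt0 k)); lra.
Qed.

(** The norms are sup norms: [n%:R] comes from bounding [dotv], and the Euclidean denominators are
    at least [|F k| ^+ 2]. *)
Lemma direction_recursion k :
  `|d k.+1| * `|F k| ^+ 2 <= `|F k.+1| * `|F k| ^+ 2 +
    2 * n%:R * `|F k.+1| * `|F k.+1 - F k| * `|d k|.
Proof.
have E0 := dotv_residual_gt0 k; have E1 := norm_sqr_le_dotv (F k).
have dv (u v : 'rV[R]_n) : `|dotv u v| <= n%:R * (`|u| * `|v|).
  by apply: dotv_le => i; apply: coord_le_norm.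
rewrite (FCG_dS run k) enorm_sqr -/(F k) -/(F k.+1).
set E := dotv (F k) (F k) in E0 E1 *; set y := F k.+1 - F k.
have -> : 2 * n%:R * `|F k.+1| * `|y| * `|d k| =
  n%:R * (`|F k.+1| * `|y|) * `|d k| + n%:R * (`|F k.+1| * `|d k|) * `|y| by ring.
have bt (a : R) (c : R) (v : 'rV[R]_n) : `|a| <= c -> `|(a / E) *: v| * `|F k| ^+ 2 <= c * `|v|.
  move=> ac; rewrite normrZ normrM normfV (gtr0_norm E0).
  have -> : `|a| / E * `|v| * `|F k| ^+ 2 = `|a| * `|v| * (`|F k| ^+ 2 / E) by ring.
  have q1 : `|F k| ^+ 2 / E <= 1 by rewrite ler_pdivrMr // mul1r.
  have q0 : 0 <= `|F k| ^+ 2 / E by rewrite divr_ge0 ?sqr_ge0 // ltW.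
  apply: (@le_trans _ _ (`|a| * `|v|)); first by rewrite ler_piMr // mulr_ge0.
  by rewrite ler_wpM2r.
have F2 : 0 <= `|F k| ^+ 2 by rewrite sqr_ge0.
have h1 := bt _ _ (d k) (dv (F k.+1) y).
have h2 := bt _ _ y (dv (F k.+1) (d k)).
apply: le_trans (ler_wpM2r F2 (ler_normB _ _)) _.
rewrite mulrDl addrA lerD //.
apply: le_trans (ler_wpM2r F2 (ler_normD _ _)) _.
by rewrite normrN mulrDl lerD.
Qed.

(** If [alpha k] is not [delta], the previous trial step [alpha k / rho] was rejected; its failed
    inequality is compared with [objective_expansion]. *)
Lemma step_lower_bound : exists2 c : R, 0 < c & exists K, forall k, (K <= k)%N ->
  delta <= alpha k \/ c * `|F k| ^+ 2 <= alpha k * `|d k| ^+ 2.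
Proof.
have /andP[rho0 rho1] := rho01; have /andP[s10 s11] := sigma1_01.
have [r r0 [C C0 ex]] := objective_expansion symA symB posB.
have Cn : 0 < C + sigma2 * n%:R by rewrite ltr_wpDr // mulr_ge0 // ltW.
exists (rho * (1 - sigma1) / (C + sigma2 * n%:R)).
  by rewrite divr_gt0 // mulr_gt0 // subr_gt0.
(* The rejected step is longer by the factor [1 / rho] and must still lie within the radius [r] of
   the expansion. *)
have rr0 : 0 < r * rho by rewrite mulr_gt0.
have [K HK] := step_size_small rr0; exists K => k /HK sk.
have [[[i ai] _] ub] := FCG_alpha run k.
case: i ai => [|i] ai; [left|right]; first by rewrite ai expr0 mulr1.
pose a := delta * rho ^+ i.
have a0 : 0 < a by rewrite mulr_gt0 // exprn_gt0.
have aE : alpha k = a * rho by rewrite ai exprSr mulrA.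
have na : ~ admissible_steps A B rho sigma1 sigma2 delta (x k) (d k) a.
  by move=> /ub; rewrite aE leNgt gtr_pMr ?rho1.
have {}na : objective A (x k) + sigma1 * a * dotv (F k) (d k) - sigma2 * a ^+ 2 * enorm (d k) ^+ 2
    < objective A (Bnormalize B (x k + a *: d k)).
  by rewrite ltNge; apply/negP => H; apply: na; split=> //; exists i.
have ad : 0 <= a * `|d k| <= r.
  apply/andP; split; first by rewrite mulr_ge0 // ltW.
  by rewrite -(ler_pM2r rho0); move: sk; rewrite /s aE; lra.
have hd j : `|(a *: d k) 0 j| <= a * `|d k|.
  by rewrite mxE normrM (gtr0_norm a0) ler_pM2l // coord_le_norm.
have := lt_le_trans na (ex (x k) (a *: d k) _ (run_sphere k).1 ad hd).
rewrite -/(F k) dotvZr enorm_sqr dotv_residual_direction => H.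
have E1 := norm_sqr_le_dotv (F k).
have dd : dotv (d k) (d k) <= n%:R * `|d k| ^+ 2.
  apply: le_trans (ler_norm _) _; rewrite expr2.
  by apply: dotv_le => j; apply: coord_le_norm.
have H1 : a * ((1 - sigma1) * `|F k| ^+ 2) <= a * ((C + sigma2 * n%:R) * (a * `|d k| ^+ 2)).
  have s1' : 0 <= a * (1 - sigma1) by rewrite mulr_ge0 // ?subr_ge0 ltW.
  have g1 := ler_wpM2l s1' E1.
  have g2 : sigma2 * a ^+ 2 * dotv (d k) (d k) <= sigma2 * a ^+ 2 * (n%:R * `|d k| ^+ 2).
    by rewrite ler_wpM2l // mulr_ge0 ?sqr_ge0 // ltW.
  lra.
rewrite ler_pM2l // in H1.
rewrite mulrAC ler_pdivrMr // aE.
have := ler_wpM2l (ltW rho0) H1; lra.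
Qed.

Lemma run_residual_vanishes e : 0 < e -> exists K, forall k, (K <= k)%N -> `|F k| < e.
Proof.
have /andP[rho0 rho1] := rho01; have /andP[s10 s11] := sigma1_01.
have [M M0 bM] := sphere_bounded posB.
have [c1 c10 [K1 lb]] := step_lower_bound.
have [r r0 [C1 C10 near1]] := Bnormalize_near posB.
have [C2 C20 [bF lF]] := residual_bounded_lipschitz A B M.
have [c2 c20 [t0 t00 lojF]] := residual_lojasiewicz symA symB posB ls.
have [K2 HK2] := step_size_small r0.
have [K3 HK3] := run_gap_small t00.
(* Beyond [K] the step bound, the normalisation estimate and the Lojasiewicz inequality all apply;
   the abstract result is used on this tail. *)
pose K := (K1 + K2 + K3)%N.
have K1K k : (K1 <= K + k)%N by rewrite /K -!addnA leq_addr.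
have K2K k : (K2 <= K + k)%N by rewrite /K [(K1 + K2)%N]addnC -!addnA leq_addr.
have K3K k : (K3 <= K + k)%N by rewrite /K [(_ + K3)%N]addnC -!addnA leq_addr.
have xM k i : `|x k 0 i| <= M by apply: bM; have [] := run_sphere k.
have a0 := alpha_gt0.
have s0 k : 0 <= s k by rewrite mulr_ge0 // ltW.
pose Cy := C2 * C1.
have Cy0 : 0 < Cy by rewrite mulr_gt0.
have yB k : (K2 <= k)%N -> `|F k.+1 - F k| <= Cy * s k.
  move=> /HK2 sk; rewrite /Cy -mulrA; apply: lF => //; first by rewrite mulr_ge0 // ltW.
  have hd j : `|(alpha k *: d k) 0 j| <= s k.
    by rewrite mxE normrM (gtr0_norm (a0 k)) ler_pM2l // coord_le_norm.
  have dr : 0 <= s k <= r by rewrite s0 ltW.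
  have [_ _ H] := near1 (x k) (alpha k *: d k) (s k) (run_sphere k).1 dr hd.
  by move=> i; rewrite (FCG_xS run).
pose c := Num.min (Num.min sigma1 sigma2) (Num.min c1 c2).
have c0 : 0 < c by rewrite !lt_min s10 sigma2_gt0 c10.
have cs1 : c <= sigma1 by rewrite !ge_min lexx.
have cs2 : c <= sigma2 by rewrite !ge_min lexx !orbT.
have cc1 : c <= c1 by rewrite !ge_min lexx !orbT.
have cc2 : c <= c2 by rewrite !ge_min lexx !orbT.
pose C := C2 + Cy + 2 * n%:R * Cy.
have nCy : 0 <= 2 * n%:R * Cy by rewrite !mulr_ge0 // ltW.
have C0 : 0 < C by rewrite /C; lra.
pose sh T (u : nat -> T) := fun k => u (K + k)%N.
have dec k : 0 <= sigma1 * alpha k * `|F k| ^+ 2 /\ 0 <= sigma2 * s k ^+ 2.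
  by rewrite !mulr_ge0 ?sqr_ge0 // ltW.
have yC k : `|F (K + k).+1 - F (K + k)%N| <= C * s (K + k)%N.
  apply: le_trans (yB _ (K2K k)) _.
  by rewrite ler_wpM2r // /C; lra.
move=> e0.
have [] := @residual_vanishes R c C delta (sh _ (fun k => lambda k - ls))
  (sh _ (fun k => `|d k|)) (sh _ s) (sh _ (fun k => `|F k|)) (sh _ alpha)
  c0 C0 delta_gt0 _ _ _ _ _ _ _ _ _ _ _ _ _ e e0.
- by move=> k; apply: run_gap_gt0.
- move=> e' e'0; have [L HL] := run_gap_small e'0; exists L => k Lk.
  by apply: HL; apply: leq_trans Lk (leq_addl _ _).
- by move=> k; apply: s0.
- by move=> k; apply: residual_norm_gt0.
- by move=> k; apply: normr_ge0.
- move=> k; apply: le_trans (bF _ (xM _)) _; rewrite /C; lra.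
- move=> k; rewrite /sh addnS; have := run_descent (K + k); have [h1 h2] := dec (K + k)%N.
  have := ler_wpM2r (sqr_ge0 (s (K + k)%N)) cs2; lra.
- move=> k; rewrite /sh addnS; have := run_descent (K + k); have [h1 h2] := dec (K + k)%N.
  have := ler_wpM2r (mulr_ge0 (ltW (a0 (K + k)%N)) (sqr_ge0 `|F (K + k)%N|)) cs1.
  lra.
- move=> k; rewrite /sh addnS; apply: le_trans (direction_recursion _) _.
  rewrite lerD2l.
  have h := yB _ (K2K k).
  have g0 : 0 <= 2 * n%:R * `|F (K + k).+1| * `|d (K + k)%N| by rewrite !mulr_ge0.
  have := ler_wpM2l g0 h.
  have g1 : 0 <= `|F (K + k).+1| * `|d (K + k)%N| * s (K + k)%N.
    exact: mulr_ge0 (mulr_ge0 (normr_ge0 _) (normr_ge0 _)) (s0 _).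
  have g2 : 2 * n%:R * Cy <= C.
    by rewrite /C lerDr addr_ge0 // ltW.
  have := ler_wpM2r g1 g2; lra.
- move=> k; rewrite /sh addnS.
  have := le_trans (ler_normD (F (K + k).+1 - F (K + k)%N) (F (K + k)%N)) (lerD (yC k) (lexx _)).
  rewrite subrK; lra.
- move=> k; rewrite /sh addnS.
  have yC' : `|F (K + k)%N - F (K + k).+1| <= C * s (K + k)%N by rewrite -normrN opprB yC.
  have := le_trans (ler_normD (F (K + k)%N - F (K + k).+1) (F (K + k).+1)) (lerD yC' (lexx _)).
  rewrite subrK; lra.
- move=> k; have [->|H] := lb _ (K1K k); [by left|right].
  by apply: le_trans H; rewrite ler_wpM2r ?sqr_ge0.
- move=> k; apply: (@le_trans _ _ (c2 * (lambda (K + k)%N - ls))).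
    by rewrite ler_wpM2r // ltW // run_gap_gt0.
  rewrite (FCG_lambda run); apply: lojF; first by have [] := run_sphere (K + k).
  by rewrite -(FCG_lambda run) run_gap_gt0 HK3.
move=> L HL; exists (K + L)%N => k KL.
have Kk : (K <= k)%N := leq_trans (leq_addr L K) KL.
have := HL (k - K)%N; rewrite /sh subnKC //; apply.
by rewrite -(leq_add2l K) subnKC.
Qed.

Lemma cluster_value (g : 'rV[R]_n -> R) (l : R) p : continuous g ->
  (forall e, 0 < e -> exists K, forall k, (K <= k)%N -> `|g (x k) - l| < e) ->
  cluster (x @ \oo) p -> g p = l.
Proof.
move=> cg gl clp; apply/eqP; rewrite -subr_eq0 -normr_le0 leNgt; apply/negP => e0.
have e2 : 0 < `|g p - l| / 2 by rewrite divr_gt0.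
have [K HK] := gl _ e2.
have N1 : (x @ \oo) [set z | `|g z - l| < `|g p - l| / 2].
  by exists K => // k /= kK; apply: HK.
have N2 : nbhs p [set z | `|g p - g z| < `|g p - l| / 2].
  by have /cvgrPdist_lt := cg p; apply.
have [z [/= z1 z2]] := clp _ _ N1 N2.
have := ler_normD (g p - g z) (g z - l); rewrite addrA subrK; lra.
Qed.

Lemma cluster_eigenvector p : cluster (x @ \oo) p -> B_eigenvector A B ls p.
Proof.
move=> clp.
have Bp : tform B p = 1.
  apply: (cluster_value (row_polynomial_continuous (tform_polynomial B)) _ clp) => e e0.
  by exists 0%N => k _; have [-> _] := run_sphere k; rewrite subrr normr0.
have Ap : tform A p = ls.
  apply: (cluster_value (row_polynomial_continuous (tform_polynomial A)) _ clp) => e e0.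
  have [K HK] := run_gap_small e0; exists K => k /HK.
  by rewrite -(FCG_lambda run) gtr0_norm // run_gap_gt0.
have Fp : residual A B p = 0.
  apply/rowP => i; rewrite [RHS]mxE.
  apply: (cluster_value (row_polynomial_continuous (residual_polynomial A B i)) _ clp) => e e0.
  have [K HK] := run_residual_vanishes e0; exists K => k /HK.
  by rewrite subr0; apply: le_lt_trans; apply: coord_le_norm.
split=> //.
  apply/eqP => p0; move: Bp; rewrite p0 tform0 => /eqP.
  by rewrite eq_sym oner_eq0.
by apply/eqP; rewrite -subr_eq0 -Ap; apply/eqP.
Qed.

Lemma run_cluster_exists : exists p, cluster (x @ \oo) p.
Proof.
have [M M0 bM] := sphere_bounded posB.
have Scl : closed [set z : 'rV[R]_n | tform B z = 1].
  exact/closed_preimage_eq/row_polynomial_continuous/tform_polynomial.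
have Sco : compact [set z : 'rV[R]_n | tform B z = 1].
  by apply: (@compact_box _ _ _ M) => // z i; apply: bM.
have [|p [_ clp]] := Sco (x @ \oo) _; last by exists p.
by exists 0%N => // k _ /=; have [] := run_sphere k.
Qed.

End Run.

Theorem theorem3 (R : realType) (m m' n : nat) (n_gt0 : (0 < n)%N)
    (A : tensor R m.+1 n) (B : tensor R m'.+1 n)
    (symA : symmetric_tensor A)
    (symB : symmetric_tensor B) (posB : posdef_tensor B)
    (even_m' : ~~ odd m'.+1)
    (rho sigma1 sigma2 delta : R)
    (rho01 : 0 < rho < 1) (sigma1_01 : 0 < sigma1 < 1)
    (sigma2_gt0 : 0 < sigma2) (delta_gt0 : 0 < delta)
    (u0 : 'rV[R]_n) (u0_neq0 : u0 != 0)
    (x d : nat -> 'rV[R]_n) (alpha lambda : nat -> R)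
    (run : FCG_run A B rho sigma1 sigma2 delta u0 x d alpha lambda) :
  exists lambda_star : R,
    [/\ nonincreasing_seq lambda,
        lambda @ \oo --> lambda_star,
        B_eigenvalue A B lambda_star &
        forall x_star : 'rV[R]_n,
          cluster (x @ \oo) x_star -> B_eigenvector A B lambda_star x_star].
Proof.
exists (limn lambda).
have eig p : cluster (x @ \oo) p -> B_eigenvector A B (limn lambda) p.
  exact: (cluster_eigenvector symA symB posB rho01 sigma1_01 sigma2_gt0 delta_gt0
    u0_neq0 run).
split=> //.
- exact: (run_nonincreasing rho01 sigma1_01 sigma2_gt0 delta_gt0 run).
- exact: (run_cvg posB rho01 sigma1_01 sigma2_gt0 delta_gt0 u0_neq0 run).
- have [p clp] := run_cluster_exists posB rho01 delta_gt0 u0_neq0 run.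
  by exists p; apply: eig.
Qed.
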